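(* Let $1\le a\leq 8$ and let $\mathcal{L}=\mathcal{L}_3(d,m_1,\ldots,m_a)$ be the linear system of surfaces of degree $d$ in $\mathbb{P}^3$ having multiplicity at least $m_i$ at $p_i$ for $i=1,\ldots,a$, where $p_1,\ldots,p_a\in\mathbb{P}^3$ are points in general position. Assume that $\mathcal{L}$ is in standard form, i.e. $m_1\geq m_2\geq\cdots\geq m_a$ and $2d\geq m_1+m_2+m_3+m_4$ (with $m_i=0$ for $i>a$). Put $t_1:=m_2+m_3-d$ and $t_i:=m_1+m_i-d$ for $2\leq i\leq a$. Then $\mathcal{L}$ is special if and only if $d\leq m_1+m_2-2$, and its dimension is given by $$\dim\mathcal{L}=v(\mathcal{L})+\sum_{1\leq i\leq a,\ t_i\geq 2}\binom{t_i+1}{3}.$$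
   Context: The ground field is algebraically closed of characteristic $0$. Degrees $d$ and multiplicities $m_i$ are integers with $m_i\geq 0$. For general points $p_1,\ldots,p_r\in\mathbb{P}^3$ and the zero-dimensional scheme $Z=\sum m_ip_i$ of fat points, $\mathcal{L}_3(d,m_1,\ldots,m_r)$ denotes the linear system associated to the sheaf $\mathcal{O}_{\mathbb{P}^3}(d)\otimes\mathcal{I}_Z$, so $\dim\mathcal{L}=h^0(\mathcal{O}_{\mathbb{P}^3}(d)\otimes\mathcal{I}_Z)-1$ (equal to $-1$ if the system is empty). Its virtual dimension is $$v(\mathcal{L})=\binom{d+3}{3}-\sum_{i=1}^r\binom{m_i+2}{3}-1 .$$ The system is called special if the conditions imposed by the multiple points on surfaces of degree $d$ are linearly dependent, i.e. $\dim\mathcal{L}>v(\mathcal{L})$.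
   Formalization: The dimension formula is stated only for m_1 ≤ d+1; without this it fails for empty systems (a=1, d=2, m_1=4: formula gives −11, but dim L = −1). The criterion ''special iff d ≤ m_1+m_2−2'' is kept without this restriction. *)

(* Defs.v *)
From mathcomp Require Import all_boot all_order all_algebra.
From mathcomp.multinomials Require Import mpoly.
From Stdlib Require Import Classical ClassicalEpsilon.

Set Implicit Arguments.
Unset Strict Implicit.
Unset Printing Implicit Defensive.

Import Order.TTheory GRing.Theory Num.Theory.
Local Open Scope ring_scope.

(* A point of P^3 is handled through a nonzero vector of homogeneous
   coordinates; every notion below is invariant under rescaling it. *)
Definition P3 (K : fieldType) : Type := {v : 'rV[K]_4 | v != 0}.

Definition config (K : fieldType) (a : nat) : Type := 'I_a -> P3 K.

(* The variable of index [mxvec_index i j] is the [j]-th homogeneous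
   coordinate of the [i]-th point. *)
Definition eval_config (K : fieldType) (a : nat)
    (F : {mpoly K[a * 4]}) (p : config K a) : K :=
  F.@[fun k => mxvec (\matrix_(i < a, j < 4) (val (p i)) 0 j) 0 k].

Definition multihomogeneous (K : fieldType) (a : nat) (F : {mpoly K[a * 4]}) :
    Prop :=
  exists e : 'I_a -> nat, forall (u : 'X_{1..a * 4}), u \in msupp F ->
    forall i : 'I_a, (\sum_(j < 4) u (mxvec_index i j))%N = e i.

(* The complement of [U] is the common zero locus in (P^3)^a of a family [S]
   of multihomogeneous polynomials. *)
Definition zariski_open (K : fieldType) (a : nat) (U : config K a -> Prop) :
    Prop :=
  exists S : {mpoly K[a * 4]} -> Prop,
    (forall F, S F -> multihomogeneous F) /\
    (forall p, U p <-> exists2 F, S F & eval_config F p != 0).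

Definition for_general_points (K : fieldType) (a : nat)
    (Q : config K a -> Prop) : Prop :=
  exists U : config K a -> Prop,
    [/\ zariski_open U, (exists p, U p) & forall p, U p -> Q p].

(* The polynomials vanishing on the line spanned by [v]; over an infinite field
   this is the homogeneous ideal of the point of P^3 it represents. *)
Definition point_ideal (K : fieldType) (p : P3 K) (f : {mpoly K[4]}) : Prop :=
  forall c : K, f.@[fun j => c * (val p) 0 j] = 0.

Definition ideal_pow (R : comNzRingType) (I : R -> Prop) (m : nat) (f : R) :
    Prop :=
  exists n (h : 'I_n -> R) (g : 'I_n -> 'I_m -> R),
    (forall k j, I (g k j)) /\ f = \sum_(k < n) h k * \prod_(j < m) g k j.

(* The saturated homogeneous ideal of the scheme Z = sum_i m_i p_i. *)
Definition fat_ideal (K : fieldType) (a : nat) (m : a.-tuple nat)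
    (p : config K a) (f : {mpoly K[4]}) : Prop :=
  forall i : 'I_a, ideal_pow (point_ideal (p i)) (tnth m i) f.

Lemma ideal_pow0 (R : comNzRingType) (I : R -> Prop) (m : nat) :
  ideal_pow I m 0.
Proof.
exists 0%N, (fun=> 0), (fun _ _ => 0); split; last by rewrite big_ord0.
by case.
Qed.

Lemma ideal_powD (R : comNzRingType) (I : R -> Prop) (m : nat) (f1 f2 : R) :
  ideal_pow I m f1 -> ideal_pow I m f2 -> ideal_pow I m (f1 + f2).
Proof.
move=> [n1 [h1 [g1 [I1 ->]]]] [n2 [h2 [g2 [I2 ->]]]].
exists (n1 + n2)%N,
  (fun k => match split k with inl x => h1 x | inr x => h2 x end),
  (fun k => match split k with inl x => g1 x | inr x => g2 x end).
split=> [k j|]; first by case: (split k).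
rewrite big_split_ord /=; congr (_ + _); apply: eq_bigr => k _.
  by rewrite -[lshift n2 k]/(unsplit (inl k)) unsplitK.
by rewrite -[rshift n1 k]/(unsplit (inr k)) unsplitK.
Qed.

Lemma ideal_powM (R : comNzRingType) (I : R -> Prop) (m : nat) (c f : R) :
  ideal_pow I m f -> ideal_pow I m (c * f).
Proof.
move=> [n [h [g [Ig ->]]]]; exists n, (fun k => c * h k), g; split => //.
by rewrite mulr_sumr; apply: eq_bigr => k _; rewrite mulrA.
Qed.

Lemma fat_ideal0 (K : fieldType) (a : nat) (m : a.-tuple nat)
  (p : config K a) : fat_ideal m p 0.
Proof. by move=> i; apply: ideal_pow0. Qed.

Lemma fat_idealZD (K : fieldType) (a : nat) (m : a.-tuple nat)
    (p : config K a) (c : K) (f g : {mpoly K[4]}) :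
  fat_ideal m p f -> fat_ideal m p g -> fat_ideal m p (c *: f + g).
Proof.
move=> If Ig i; apply: ideal_powD (Ig i).
by rewrite -mul_mpolyC; apply: ideal_powM.
Qed.

Lemma vspace_of_submod (K : fieldType) (V : vectType K) (P : V -> Prop) :
  P 0 -> (forall c u v, P u -> P v -> P (c *: u + v)) ->
  exists W : {vspace V}, forall v, v \in W <-> P v.
Proof.
move=> P0 PZD.
suff grow n (W : {vspace V}) : (\dim {:V} - \dim W <= n)%N ->
    (forall v, v \in W -> P v) ->
    exists W : {vspace V}, forall v, v \in W <-> P v.
  apply: (grow _ 0%VS (leq_subr _ _)) => v.
  by rewrite memv0 => /eqP ->.
elim: n W => [|n IHn] W leWn WP.
  exists W => v; split=> [/WP // | _].
  have /eqP -> : W == fullv by rewrite eqEdim subvf -subn_eq0 -leqn0.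
  exact: memvf.
have [maxW|] := classic (forall v, P v -> v \in W).
  by exists W => v; split; [apply: WP | apply: maxW].
move=> /not_all_ex_not [v nWv].
have [Pv /negP vW] := imply_to_and _ _ nWv.
apply: (IHn (<[v]> + W)%VS); last first.
  by move=> _ /memv_addP [_ /vlineP [c ->] [w /WP Pw ->]]; apply: PZD.
have ltW : (\dim W < \dim (<[v]> + W)%VS)%N.
  rewrite (ltn_leqif (dimv_leqif_sup (addvSr <[v]> W))).
  apply: contra vW => /subvP; apply.
  by apply: (subvP (addvSl _ _)); apply: memv_line.
rewrite -ltnS; apply: leq_trans leWn.
by rewrite ltn_sub2l // (leq_trans ltW) // dimvS // subvf.
Qed.

Lemma linear_system_subproof (K : fieldType) (d a : nat) (m : a.-tuple nat)
    (p : config K a) :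
  exists W : {vspace dhomog 4 K d},
    forall f, f \in W <-> fat_ideal m p (mpoly_of_dhomog f).
Proof.
apply: vspace_of_submod => [|c f g]; first exact: fat_ideal0.
exact: fat_idealZD.
Qed.

(* H^0(O(d) (x) I_Z), the forms of degree d belonging to the ideal of Z; it is
   characterized by [mem_linear_system]. *)
Definition linear_system (K : fieldType) (d a : nat) (m : a.-tuple nat)
    (p : config K a) : {vspace dhomog 4 K d} :=
  proj1_sig (constructive_indefinite_description _
    (linear_system_subproof d m p)).

Lemma mem_linear_system (K : fieldType) (d a : nat) (m : a.-tuple nat)
    (p : config K a) (f : dhomog 4 K d) :
  f \in linear_system d m p <-> fat_ideal m p (mpoly_of_dhomog f).
Proof.
rewrite /linear_system; case: constructive_indefinite_description => W /=.
exact.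
Qed.

Definition dim_system (K : fieldType) (d a : nat) (m : a.-tuple nat)
    (p : config K a) : int :=
  (\dim (linear_system d m p))%:Z - 1.

Definition virtual_dim (d a : nat) (m : a.-tuple nat) : int :=
  'C(d + 3, 3)%:Z - \sum_(i < a) 'C(tnth m i + 2, 3)%:Z - 1.

Definition special (K : fieldType) (d a : nat) (m : a.-tuple nat)
    (p : config K a) : Prop :=
  virtual_dim d m < dim_system d m p.

(* The multiplicity m_i, with i counted from 1, and m_i = 0 for i > a. *)
Definition mult (a : nat) (m : a.-tuple nat) (i : nat) : nat :=
  nth 0%N (0%N :: m) i.

Definition standard_form (d a : nat) (m : a.-tuple nat) : Prop :=
  sorted geq m /\
  (mult m 1 + mult m 2 + mult m 3 + mult m 4 <= 2 * d)%N.

Definition t_ (d a : nat) (m : a.-tuple nat) (i : nat) : int :=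
  if i == 1%N then (mult m 2)%:Z + (mult m 3)%:Z - d%:Z
  else (mult m 1)%:Z + (mult m i)%:Z - d%:Z.

(* Main.v *)
(* The dimension of the system is upper semicontinuous in the points, so it is
   enough to bound it from above at one configuration and from below at a general
   one.

   Upper bound: put the eight points on the quadric Q : X0 X3 = X1 X2. Restriction
   to Q gives h(d; m) <= h(d - 2; m - 1) + h_Q(d, d; m), and the right-hand side
   telescopes to the expected value because passing from (d; m) to (d - 2; m - 1)
   leaves every t_i unchanged; it ends at a system with at most three points
   (monomials) or with m_1 = d + 1 (empty). On Q the points are taken
   alternately on the conics y = x and y = x + 1, which are tangent at infinity.
   Removing both conics lowers (d, d; m) to (d - 2, d - 2; m - 1), at a cost of
   (2d + 1 - S) + (2d - 1 - S'), where S and S' are the sums of the multiplicities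
   on each conic. This fails only for S' = 2d, when all m_i equal d/2; then the
   sections on the two conics glue only if they vanish, by comparing two leading
   coefficients. With m_4 = 0, or m_1 = d + 1 on Q, rulings are removed instead.

   Lower bound: in coordinates where p_1, ..., p_4 are the vertices the system is
   spanned by monomials. Each further point p_i imposes at most
   C(m_i + 2, 3) - C(t_i + 1, 3) conditions on surfaces of multiplicity m_1 at p_1,
   again by counting monomials, now with p_1 and p_i as vertices. *)

Require Import Defs.
From HB Require Import structures.
From mathcomp Require Import all_boot all_order all_algebra.
From mathcomp.multinomials Require Import ssrcomplements mpoly.
From mathcomp Require Import zify ring.

Set Implicit Arguments.
Unset Strict Implicit.
Unset Printing Implicit Defensive.

Import Order.TTheory GRing.Theory Num.Theory.
Local Open Scope ring_scope.

(** Multiplicity appears in three forms, since no single one serves every step. Powers of the point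
    ideal define the system. Hasse derivatives depend polynomially on the point, so the conditions
    form a matrix over the coordinate ring of configurations. Low coefficients along an arc behave
    well under products, so the equation of a curve or of the quadric can be divided out.
    Rank-nullity moves between subspaces of infinite-dimensional spaces on which [K] acts through
    different ring maps; hence a notion of dimension tested on finite families. Semicontinuity is
    the persistence of one nonzero minor, of size the rank of the condition matrix at the special
    configuration. Multiplied by the determinants of the coordinate systems used in the lower bound,
    it gives a single multihomogeneous polynomial whose nonvanishing is the required open set. The
    case [m_1 > d + 1] is treated apart: one point then imposes more conditions than there are forms
    of degree [d]. *)

(* [P] spans dimension at most [N] over [K]: every finite family in [P] has its
   relations cut out by [N] linear conditions. The scalars act through [iota],
   which lets [{poly {poly K}}] be used with its [{poly K}]-module structure. *)
Definition dim_le (K : fieldType) (R : comNzRingType) (V : lmodType R)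
    (iota : {rmorphism K -> R}) (P : V -> Prop) (N : nat) : Prop :=
  forall M (w : 'I_M -> V), (forall i, P (w i)) ->
    exists C : 'M[K]_(M, N), forall c : 'rV[K]_M,
      c *m C = 0 -> \sum_i iota (c 0 i) *: w i = 0.

Definition subspace (K : fieldType) (R : comNzRingType) (V : lmodType R)
    (iota : {rmorphism K -> R}) (P : V -> Prop) : Prop :=
  P 0 /\ forall c u v, P u -> P v -> P (iota c *: u + v).

Lemma semilinear_sum (K : fieldType) (R R' : comNzRingType) (V : lmodType R)
    (V' : lmodType R') (iota : {rmorphism K -> R}) (iota' : {rmorphism K -> R'})
    (f : V -> V') :
  (forall c u v, f (iota c *: u + v) = iota' c *: f u + f v) ->
  forall M (c : 'I_M -> K) (w : 'I_M -> V),
    f (\sum_i iota (c i) *: w i) = \sum_i iota' (c i) *: f (w i).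
Proof.
move=> fL M c w.
have f0 : f 0 = 0.
  have := fL 1 0 0; rewrite scaler0 addr0 rmorph1 scale1r => /eqP.
  by rewrite -subr_eq subrr => /eqP.
apply: (big_ind2 (fun x y => f x = y)) => // [x1 x2 y1 y2 E1 E2|i _].
  by rewrite -[x1]scale1r -(rmorph1 iota) fL rmorph1 scale1r E1 E2.
by rewrite -[LHS]/(f _) -[X in f X]addr0 fL f0 addr0.
Qed.

(** * Dimension bounds and rank-nullity on finite families *)

Section DimLe.
Variables (K : fieldType) (R : comNzRingType) (V : lmodType R).
Variable iota : {rmorphism K -> R}.

Lemma subspace_sum (P : V -> Prop) M (c : 'I_M -> K) (w : 'I_M -> V) :
  subspace iota P -> (forall i, P (w i)) -> P (\sum_i iota (c i) *: w i).
Proof.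
move=> [P0 PD] Pw; elim/big_rec: _ => // i x _ Px.
exact: PD.
Qed.

Lemma dim_le_sub (P P' : V -> Prop) (N : nat) :
  (forall v, P v -> P' v) -> dim_le iota P' N -> dim_le iota P N.
Proof. by move=> PP' HP M w Pw; apply: HP => i; apply: PP'. Qed.

Lemma dim_le_coord (P : V -> Prop) (N : nat) (phi : 'I_N -> V -> K) :
  subspace iota P ->
  (forall j c u v, phi j (iota c *: u + v) = c * phi j u + phi j v) ->
  (forall v, P v -> (forall j, phi j v = 0) -> v = 0) ->
  dim_le iota P N.
Proof.
move=> sP phiL phi0 M w Pw; exists (\matrix_(i, j) phi j (w i)) => c cC.
apply: phi0 => [|j]; first exact: subspace_sum.
have -> : phi j (\sum_i iota (c 0 i) *: w i) = \sum_i c 0 i * phi j (w i).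
  exact: (@semilinear_sum K R K V K^o iota idfun (phi j) (phiL j)).
move/matrixP/(_ 0 j): cC; rewrite !mxE => E; rewrite -[RHS]E.
by apply: eq_bigr => i _; rewrite mxE.
Qed.

Lemma dim_le0 (P : V -> Prop) :
  (forall v, P v -> v = 0) -> dim_le iota P 0.
Proof.
move=> P0 M w Pw; exists 0 => c _.
by rewrite big1 // => i _; rewrite (P0 _ (Pw i)) scaler0.
Qed.

(* Rank-nullity for [theta], whose kernel on [P] is covered by [psi]. *)
Lemma dim_le_step (R2 : comNzRingType) (V2 : lmodType R2)
    (iota2 : {rmorphism K -> R2}) (R' : comNzRingType) (V' : lmodType R')
    (iota' : {rmorphism K -> R'})
    (P : V -> Prop) (P2 : V2 -> Prop) (P' : V' -> Prop) (N2 N' : nat)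
    (theta : V -> V2) (psi : V' -> V) :
  subspace iota P ->
  (forall c u v, theta (iota c *: u + v) = iota2 c *: theta u + theta v) ->
  (forall c u v, psi (iota' c *: u + v) = iota c *: psi u + psi v) ->
  (forall v, P v -> P2 (theta v)) ->
  (forall v, P v -> theta v = 0 -> exists2 v', P' v' & v = psi v') ->
  dim_le iota2 P2 N2 -> dim_le iota' P' N' -> dim_le iota P (N2 + N').
Proof.
move=> sP thL psL PP2 kerP H2 H' M w Pw.
have thS (c : 'I_M -> K) :
    theta (\sum_i iota (c i) *: w i) = \sum_i iota2 (c i) *: theta (w i).
  exact: semilinear_sum.
have [C2 HC2] := H2 M (theta \o w) (fun i => PP2 _ (Pw i)).
pose k := kermx C2.
have kP j : exists v', P' v' /\ \sum_i iota (k j i) *: w i = psi v'.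
  have [||v' Pv' E] := kerP (\sum_i iota (k j i) *: w i).
  - exact: subspace_sum.
  - rewrite thS -[RHS](HC2 (row j k)); last by rewrite -row_mul mulmx_ker row0.
    by apply: eq_bigr => i _; rewrite [row j k 0 i]mxE.
  - by exists v'.
pose v' j := proj1_sig (ClassicalEpsilon.constructive_indefinite_description _ (kP j)).
have v'P j : P' (v' j) /\ \sum_i iota (k j i) *: w i = psi (v' j).
  by rewrite /v'; case: ClassicalEpsilon.constructive_indefinite_description.
have [C' HC'] := H' M v' (fun j => proj1 (v'P j)).
(* A relation [c] killed by [C2] lies in the row space of [k]; [c *m pinvmx k] gives its coordinates
   there, and these are what [C'] tests. *)
exists (row_mx C2 (pinvmx k *m C')) => c.
rewrite mul_mx_row => cC; have cC2 : c *m C2 = 0.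
  by move/(congr1 lsubmx): cC; rewrite row_mxKl linear0.
have {cC} cC' : c *m pinvmx k *m C' = 0.
  by move/(congr1 rsubmx): cC; rewrite row_mxKr linear0 mulmxA.
have ck : c *m pinvmx k *m k = c by rewrite mulmxKpV // sub_kermx cC2.
set b := c *m pinvmx k in cC' ck.
have -> : \sum_i iota (c 0 i) *: w i = psi (\sum_j iota' (b 0 j) *: v' j).
  rewrite -ck (semilinear_sum psL).
  under [RHS]eq_bigr => j _ do rewrite -(proj2 (v'P j)) scaler_sumr.
  rewrite exchange_big; apply: eq_bigr => i _ /=.
  rewrite mxE rmorph_sum scaler_suml; apply: eq_bigr => j _.
  by rewrite rmorphM scalerA.
rewrite HC' //; have := psL 1 0 0; rewrite scaler0 addr0 rmorph1 scale1r => /eqP.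
by rewrite -subr_eq subrr => /eqP.
Qed.

End DimLe.

(** * Curves on the quadric *)

Section Eval2.
Variables (K A : comNzRingType) (iota : {rmorphism K -> A}) (a b : A).

Definition ev1 : {poly K} -> A := horner_eval a \o map_poly iota.
HB.instance Definition _ :=
  GRing.RMorphism.copy ev1 (horner_eval a \o map_poly iota).

(** The inner variable [x] is sent to [a] and the outer variable [y] to [b]. Accordingly [size F]
    bounds the degree in [y] and [size (swapXY F)] the degree in [x]. *)
Definition ev2 : {poly {poly K}} -> A := horner_eval b \o map_poly ev1.
HB.instance Definition _ :=
  GRing.RMorphism.copy ev2 (horner_eval b \o map_poly ev1).

Lemma ev1C c : ev1 c%:P = iota c.
Proof. by rewrite /ev1 /= /horner_eval map_polyC hornerC. Qed.

Lemma ev1X : ev1 'X = a.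
Proof. by rewrite /ev1 /= /horner_eval map_polyX hornerX. Qed.

Lemma ev2C p : ev2 p%:P = ev1 p.
Proof. by rewrite /ev2 /= /horner_eval map_polyC hornerC. Qed.

Lemma ev2X : ev2 'X = b.
Proof. by rewrite /ev2 /= /horner_eval map_polyX hornerX. Qed.

Lemma ev2Z c F : ev2 (c%:P *: F) = iota c * ev2 F.
Proof. by rewrite -mul_polyC rmorphM /= ev2C ev1C. Qed.

Lemma ev2_XsubC p : ev2 ('X - p%:P) = b - ev1 p.
Proof. by rewrite rmorphB /= ev2X ev2C. Qed.

Lemma ev1_XsubC c : ev1 ('X - c%:P) = a - iota c.
Proof. by rewrite rmorphB /= ev1X ev1C. Qed.

Lemma ev1_XaddC c : ev1 ('X + c%:P) = a + iota c.
Proof. by rewrite rmorphD /= ev1X ev1C. Qed.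

Lemma ev1E (p : {poly K}) n : (size p <= n)%N -> ev1 p = \sum_(i < n) iota p`_i * a ^+ i.
Proof.
move=> np; have -> : p = \poly_(i < n) p`_i.
  apply/polyP => i; rewrite coef_poly; case: ltnP => // ni.
  by rewrite nth_default // (leq_trans np).
rewrite [in LHS]poly_def rmorph_sum; apply: eq_bigr => i _ /=.
by rewrite -mul_polyC rmorphM /= rmorphXn /= ev1X ev1C coef_poly ltn_ord.
Qed.

Lemma ev2E (F : {poly {poly K}}) n k : (size F <= k)%N -> (size (swapXY F) <= n)%N ->
  ev2 F = \sum_(j < k) \sum_(i < n) iota F`_j`_i * a ^+ i * b ^+ j.
Proof.
move=> kF nF; have -> : F = \poly_(j < k) F`_j.
  apply/polyP => j; rewrite coef_poly; case: ltnP => // kj.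
  by rewrite nth_default // (leq_trans kF).
rewrite [in LHS]poly_def rmorph_sum; apply: eq_bigr => j _ /=.
rewrite -mul_polyC rmorphM /= rmorphXn /= ev2X ev2C coef_poly ltn_ord -mulr_suml.
congr (_ * _); apply: ev1E; apply/leq_sizeP => i ni; rewrite -coef_swapXY.
by rewrite [_`_i]nth_default ?coef0 // (leq_trans nF).
Qed.
End Eval2.

Lemma ev2_comp (K A B : comNzRingType) (iota : {rmorphism K -> A})
    (g : {rmorphism A -> B}) (kappa : {rmorphism K -> B}) a b F :
  g \o iota =1 kappa -> g (ev2 iota a b F) = ev2 kappa (g a) (g b) F.
Proof.
move=> E; rewrite !(ev2E _ _ _ (leqnn _) (leqnn _)) rmorph_sum; apply: eq_bigr => j _.
rewrite rmorph_sum; apply: eq_bigr => i _.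
by rewrite !rmorphM !rmorphXn -[kappa _]E.
Qed.

(** The [k]-th coefficient of [e * G] is the constant term of [e] times the [k]-th coefficient of
    [G], plus terms in lower coefficients of [G]. *)
Lemma coef_low_cancel (D : idomainType) (e G : {poly D}) m :
  e`_0 != 0 -> (forall k, (k < m)%N -> (e * G)`_k = 0) ->
  forall k, (k < m)%N -> G`_k = 0.
Proof.
move=> e0 H k; elim/ltn_ind: k => k IH km.
have := H k km; rewrite coefM big_ord_recl /= subn0 big1 ?addr0 => [|i _].
  by move/eqP; rewrite mulf_eq0 (negPf e0) /= => /eqP.
by rewrite IH ?mulr0 /bump //=; case: i => i /= Hi; lia.
Qed.

Lemma coef_low_cancel1 (D : idomainType) (e G : {poly D}) m :
  e`_0 = 0 -> e`_1 != 0 -> (forall k, (k < m)%N -> (e * G)`_k = 0) ->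
  forall k, (k < m.-1)%N -> G`_k = 0.
Proof.
move=> e0 e1 H; apply: (@coef_low_cancel _ (drop_poly 1 e)).
  by rewrite coef_drop_poly.
move=> k km; rewrite -[in RHS](H k.+1); last by lia.
rewrite -[e in RHS](poly_take_drop 1).
have -> : take_poly 1 e = 0.
  by apply/polyP => -[|i]; rewrite coef_take_poly coef0 //=.
by rewrite add0r expr1 mulrAC coefMX.
Qed.

Lemma dvdp_coprime_prod (F : fieldType) (I : eqType) (s : seq I) (q : I -> {poly F}) p :
  uniq s -> {in s &, forall i j, i != j -> coprimep (q i) (q j)} ->
  (forall i, i \in s -> q i %| p) -> \prod_(i <- s) q i %| p.
Proof.
elim: s => [|x s IH] /=; first by rewrite big_nil dvd1p.
move=> /andP[xs us] cop div; rewrite big_cons Gauss_dvdp.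
  rewrite div ?inE ?eqxx //= IH // => [i j si sj|i si].
    by apply: cop; rewrite inE ?si ?sj orbT.
  by apply: div; rewrite inE si orbT.
rewrite big_seq; elim/big_rec: _ => [|i r si cr]; first by rewrite coprimep1.
rewrite coprimepMr cr andbT; apply: cop; rewrite ?inE ?eqxx ?si ?orbT //.
by apply: contraNneq xs => ->.
Qed.

Lemma dvdp_prod_XsubC_exp (F : fieldType) r (on : pred 'I_r) (z : 'I_r -> F)
    (m : 'I_r -> nat) p :
  {in on &, injective z} -> (forall i, on i -> ('X - (z i)%:P) ^+ m i %| p) ->
  \prod_(i | on i) ('X - (z i)%:P) ^+ m i %| p.
Proof.
move=> inj div; rewrite -big_filter; apply: dvdp_coprime_prod.
- by rewrite filter_uniq // index_enum_uniq.
- move=> i j; rewrite !mem_filter => /andP[oi _] /andP[oj _] ij.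
  apply/coprimep_expl/coprimep_expr/coprimep_XsubC2.
  by rewrite subr_eq0; apply: contra ij => /eqP/inj ->.
- by move=> i; rewrite mem_filter => /andP[oi _]; apply: div.
Qed.

Lemma size_prod_XsubC_exp (F : fieldType) r (on : pred 'I_r) (z : 'I_r -> F)
    (m : 'I_r -> nat) :
  size (\prod_(i | on i) ('X - (z i)%:P) ^+ m i) = (\sum_(i | on i) m i).+1.
Proof.
rewrite size_prod => [|i _]; last by rewrite expf_neq0 // polyXsubC_eq0.
have -> : (\sum_(i | on i) size (('X - (z i)%:P) ^+ m i) =
           \sum_(i | on i) m i + #|on|)%N.
  by rewrite -sum1_card -big_split; apply: eq_bigr => i _; rewrite size_exp_XsubC -[LHS]addn1.
by rewrite -addSn addnK.
Qed.

(** The coordinates are the coefficients of the quotient by [Q]. When [L <= s] only [p = 0] is left,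
    in agreement with the truncated [L - s]. *)
Lemma dim_le_multiples (F : fieldType) (Q : {poly F}) L s :
  size Q = s.+1 ->
  dim_le idfun (fun p : {poly F} => (size p <= L)%N /\ Q %| p) (L - s).
Proof.
move=> sQ; have Q0 : Q != 0 by rewrite -size_poly_gt0 sQ.
apply: (@dim_le_coord _ _ _ _ _ _ (fun j p => (p %/ Q)`_j)).
- split=> [|c u v [su Qu] [sv Qv]]; first by rewrite size_poly0 dvdp0.
  split; last by rewrite dvdp_add // -mul_polyC dvdp_mull.
  rewrite (leq_trans (size_polyD _ _)) // geq_max sv andbT.
  exact: leq_trans (size_scale_leq _ _) su.
- by move=> j c u v /=; rewrite divpD divpZl coefD coefZ.
- move=> p [sp /divpK E] H; rewrite -E.
  suff -> : p %/ Q = 0 by rewrite mul0r.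
  apply/polyP => j; rewrite coef0; case: (ltnP j (L - s)) => jL.
    by rewrite (H (Ordinal jL)).
  by rewrite nth_default // size_divp // sQ (leq_trans _ jL) // leq_sub2r.
Qed.

Definition polyC2 (K : fieldType) : {rmorphism K -> {poly {poly K}}} :=
  GRing.RMorphism.clone _ _ (polyC \o polyC) _.

(* Vanishing to order [m] at [(x, y)], tested on the lines through [(x, y)]:
   the direction [(s, 2 - s)] is generic and specializes to the horizontal, the
   vertical and the diagonal one. *)
Definition vanish (K : fieldType) (m : nat) (x y : K) (F : {poly {poly K}}) :
    Prop :=
  forall k, (k < m)%N ->
    (ev2 (polyC2 K) (x%:P%:P + 'X%:P * 'X)
                    (y%:P%:P + (2%:R - 'X)%:P * 'X) F)`_k = 0.

(** [n] and [k] count the exponents available in [x] and [y]: the bidegree is [(n - 1, k - 1)], and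
    [n = 0] or [k = 0] leaves only zero. *)
Definition biforms (K : fieldType) r (x y : 'I_r -> K) (n k : nat)
    (m : 'I_r -> nat) (F : {poly {poly K}}) : Prop :=
  [/\ (size F <= k)%N, (size (swapXY F) <= n)%N &
      forall i, vanish (m i) (x i) (y i) F].

Section Curves.
Variables (K : fieldType) (r : nat) (x y : 'I_r -> K).

Lemma vanish_subspace m (u v : K) : subspace (@polyC K) (vanish m u v).
Proof.
split=> [k _|c F G vF vG k km]; first by rewrite rmorph0 coef0.
by rewrite rmorphD /= ev2Z coefD -[polyC2 K c]/(c%:P%:P) coefCM vF // vG // mulr0 addr0.
Qed.

Lemma biforms_subspace n k m : subspace (@polyC K) (biforms x y n k m).
Proof.
split=> [|c F G [kF nF vF] [kG nG vG]].
  split; rewrite ?rmorph0 ?size_poly0 // => i.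
  exact: (proj1 (vanish_subspace _ _ _)).
split=> [||i]; last exact: (proj2 (vanish_subspace _ _ _)).
  rewrite (leq_trans (size_polyD _ _)) // geq_max kG andbT.
  exact: leq_trans (size_scale_leq _ _) kF.
rewrite rmorphD /= -mul_polyC rmorphM /= swapXY_polyC map_polyC /=.
rewrite (leq_trans (size_polyD _ _)) // geq_max nG andbT mul_polyC.
exact: leq_trans (size_scale_leq _ _) nF.
Qed.

Lemma size_ev2_curve (a b : {poly K}) n k l (F : {poly {poly K}}) :
  (size F <= k)%N -> (size (swapXY F) <= n)%N ->
  (forall i j, (i < n)%N -> (j < k)%N -> (size (a ^+ i * b ^+ j)%R <= l)%N) ->
  (size (ev2 (@polyC K) a b F) <= l)%N.
Proof.
move=> kF nF H; rewrite (ev2E _ _ _ kF nF); apply: (leq_trans (size_sum _ _ _)).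
apply/bigmax_leqP => j _; apply: (leq_trans (size_sum _ _ _)).
apply/bigmax_leqP => i _; rewrite -mulrA mul_polyC.
exact: leq_trans (size_scale_leq _ _) (H _ _ _ _).
Qed.

(** In the chart [(x, y)] the rulings and the conics [y = x + delta] are all straight lines.
    Substituting [z + c 'X] for the parameter turns the restriction to the curve into the generic
    test line with its direction specialized at [s]; [c] absorbs the normalization [(s, 2 - s)]. *)
Lemma vanish_curve (a b : {poly K}) (s c z u v : K) m F :
  c != 0 -> a \Po (z%:P + c *: 'X) = u%:P + s *: 'X ->
  b \Po (z%:P + c *: 'X) = v%:P + (2%:R - s) *: 'X ->
  vanish m u v F -> ('X - z%:P) ^+ m %| ev2 (@polyC K) a b F.
Proof.
move=> c0 Ea Eb vF; set P := ev2 _ _ _ _.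
pose q := z%:P + c *: 'X.
have EP : P \Po q = map_poly (horner_eval s)
    (ev2 (polyC2 K) (u%:P%:P + 'X%:P * 'X) (v%:P%:P + (2%:R - 'X)%:P * 'X) F).
  rewrite [LHS](@ev2_comp _ _ _ _ (comp_poly q) (@polyC K)); last first.
    by move=> t /=; rewrite comp_polyC.
  rewrite (@ev2_comp _ _ _ _ _ (@polyC K)); last first.
    by move=> t /=; rewrite map_polyC /= /horner_eval hornerC.
  have -> : (2%:R - 'X : {poly K}) = - ('X - 2%:R%:P) by rewrite opprB polyC_natr.
  rewrite !rmorphD !rmorphM /= !map_polyC !map_polyX /= /horner_eval Ea Eb.
  by rewrite hornerN !hornerE opprB !mul_polyC.
have div : 'X^m %| P \Po q.
  rewrite -[P \Po q](poly_take_drop m) dvdp_add ?dvdp_mull //.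
  suff -> : take_poly m (P \Po q) = 0 by rewrite dvdp0.
  apply/polyP => k; rewrite coef_take_poly coef0; case: ifP => // km.
  by rewrite EP coef_map vF //= /horner_eval hornerC.
pose q' := c^-1 *: ('X - z%:P).
have qq' : q \Po q' = 'X.
  rewrite /q comp_polyD comp_polyC comp_polyZ comp_polyX scalerA divff //.
  by rewrite scale1r addrC subrK.
have := dvdp_comp_poly q' div; rewrite -comp_polyA qq' comp_polyXr rmorphXn /=.
rewrite comp_polyX exprZn dvdpZl //.
by rewrite expf_neq0 // invr_eq0.
Qed.

(* [e] has order [0] or [1] at [(u, v)], according to [b]. *)
Definition simple_at (b : bool) (u v : K) (e : {poly {poly K}}) : Prop :=
  let e' := ev2 (polyC2 K) (u%:P%:P + 'X%:P * 'X)
                           (v%:P%:P + (2%:R - 'X)%:P * 'X) e in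
  if b then e'`_0 = 0 /\ e'`_1 != 0 else e'`_0 != 0.

Lemma vanish_cancel b m u v (e F : {poly {poly K}}) :
  simple_at b u v e -> vanish m u v (e * F) -> vanish (m - b) u v F.
Proof.
rewrite /simple_at /vanish rmorphM; case: b => /=.
  by move=> [e0 e1] H; rewrite subn1; apply: coef_low_cancel1 H.
by move=> e0 H; rewrite subn0; apply: coef_low_cancel H.
Qed.

(** Restrictions to the curve have [l] coefficients and are divisible by the product of the powers
    imposed at its points, which accounts for [l] minus the sum. What restricts to zero is divisible
    by the equation [e], and the division costs one multiplicity exactly at the points of the
    curve. *)
Lemma curve_step n k n' k' l (m : 'I_r -> nat) (on : pred 'I_r) (z : 'I_r -> K)
    (a b : {poly K}) (s c : K) (e : {poly {poly K}}) N :
  c != 0 ->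
  (forall F : {poly {poly K}}, (size F <= k)%N -> (size (swapXY F) <= n)%N ->
     (size (ev2 (@polyC K) a b F) <= l)%N) ->
  (forall F : {poly {poly K}}, (size F <= k)%N -> (size (swapXY F) <= n)%N ->
     ev2 (@polyC K) a b F = 0 ->
     exists G : {poly {poly K}}, [/\ F = e * G, (size G <= k')%N & (size (swapXY G) <= n')%N]) ->
  {in on &, injective z} ->
  (forall i, on i -> a \Po ((z i)%:P + c *: 'X) = (x i)%:P + s *: 'X /\
     b \Po ((z i)%:P + c *: 'X) = (y i)%:P + (2%:R - s) *: 'X) ->
  (forall i, simple_at (on i) (x i) (y i) e) ->
  dim_le (@polyC K) (biforms x y n' k' (fun i => m i - on i)%N) N ->
  dim_le (@polyC K) (biforms x y n k m) ((l - \sum_(i | on i) m i) + N).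
Proof.
move=> c0 sz ker inj onz ord; pose Q := \prod_(i | on i) ('X - (z i)%:P) ^+ m i.
apply: (@dim_le_step _ _ _ _ _ _ (idfun : {rmorphism K -> K}) _ _ _ _
    (fun p : {poly K} => (size p <= l)%N /\ Q %| p) _ _ _
    (ev2 (@polyC K) a b) (fun G => e * G)).
- exact: biforms_subspace.
- by move=> t u v; rewrite rmorphD /= ev2Z mul_polyC.
- by move=> t u v; rewrite mulrDr -!mul_polyC; ring.
- move=> F [kF nF vF]; split; first exact: sz.
  apply: (dvdp_prod_XsubC_exp inj) => i oi; have [Ea Eb] := onz i oi.
  exact: vanish_curve c0 Ea Eb (vF i).
- move=> F [kF nF vF] F0; have [G [E kG nG]] := ker F kF nF F0.
  exists G => //; split=> // i; apply: vanish_cancel (ord i) _.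
  by rewrite -E; apply: vF.
- exact/dim_le_multiples/size_prod_XsubC_exp.
Qed.
End Curves.

Section Graphs.
Variable K : fieldType.

Lemma ev2_swap (A : comNzRingType) (iota : {rmorphism K -> A}) a b F :
  ev2 iota a b (swapXY F) = ev2 iota b a F.
Proof.
have sF := leqnn (size (swapXY F)); have sF' := leqnn (size F).
rewrite (ev2E iota b a sF' sF) (ev2E iota a b sF (n := size F)) ?swapXYK //.
rewrite exchange_big; apply: eq_bigr => i _; apply: eq_bigr => j _.
by rewrite coef_swapXY mulrAC.
Qed.

Lemma ev2_graph b F : ev2 (@polyC K) 'X b F = F.[b].
Proof.
rewrite -[ev2 _ _ _ _]/(map_poly _ F).[b]; congr (_.[b]).
apply/polyP => i; rewrite coef_map /= (ev1E _ _ (leqnn _)) -[RHS]coefK poly_def.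
by apply: eq_bigr => j _; rewrite mul_polyC.
Qed.

Lemma graph_factor (b : {poly K}) n k h (F : {poly {poly K}}) :
  size (swapXY ('X - b%:P)) = h.+1 -> (size F <= k.+1)%N ->
  (size (swapXY F) <= n + h)%N -> ev2 (@polyC K) 'X b F = 0 ->
  exists G : {poly {poly K}}, [/\ F = ('X - b%:P) * G, (size G <= k)%N &
    (size (swapXY G) <= n)%N].
Proof.
move=> sh; rewrite ev2_graph => kF nF /rootP/factor_theorem [G E].
exists G; rewrite mulrC; split=> //.
  have [->|G0] := eqVneq G 0; first by rewrite size_poly0.
  by move: kF; rewrite E size_Mmonic ?monicXsubC // size_XsubC addn2.
have [->|G0] := eqVneq (swapXY G) 0; first by rewrite size_poly0.
have e0 : swapXY ('X - b%:P) != 0 by rewrite -size_poly_gt0 sh.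
by move: nF; rewrite E rmorphM size_mul // sh addnS /= leq_add2r.
Qed.

Lemma coef_affine (R : nzRingType) (u v : R) :
  ((u%:P + v%:P * 'X)`_0 = u) * ((u%:P + v%:P * 'X)`_1 = v).
Proof.
by rewrite !coefD !coefC !coefCM !coefX /= mulr0 mulr1 addr0 add0r.
Qed.

Lemma affine_neq0 (u v : K) : (u != 0) || (v != 0) -> u%:P + v *: 'X != 0.
Proof.
apply: contraL => /eqP/polyP E; have := E 0%N; have := E 1%N.
rewrite !coef0 !coefD !coefC !coefZ !coefX /= add0r mulr1 mulr0 addr0.
by move=> -> ->; rewrite eqxx.
Qed.

Lemma size_swap_XsubC (t : K) : size (swapXY ('X - t%:P%:P)) = 1.
Proof.
rewrite rmorphB /= swapXY_X swapXY_polyC map_polyC /= -polyCB size_polyC.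
by rewrite polyXsubC_eq0.
Qed.

Lemma conic_factor (delta : K) n k (F : {poly {poly K}}) :
  (size F <= k.+1)%N -> (size (swapXY F) <= n.+1)%N ->
  ev2 (@polyC K) 'X ('X + delta%:P) F = 0 ->
  exists G : {poly {poly K}}, [/\ F = ('X - ('X + delta%:P)%:P) * G,
    (size G <= k)%N & (size (swapXY G) <= n)%N].
Proof.
move=> kF nF F0; apply: (graph_factor (n := n) (h := 1) _ kF _ F0).
  rewrite rmorphB /= swapXY_X swapXY_polyC rmorphD /= map_polyX map_polyC /=.
  have -> : 'X%:P - ('X + delta%:P%:P) = - ('X - ('X - delta%:P)%:P) :> {poly {poly K}}.
    by rewrite !rmorphB /=; ring.
  by rewrite size_polyN size_XsubC.
by rewrite addn1.
Qed.

Lemma conic_arc (u delta : K) :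
  'X \Po (u%:P + 1 *: 'X) = u%:P + 1 *: 'X /\
  ('X + delta%:P) \Po (u%:P + 1 *: 'X) = (u + delta)%:P + (2%:R - 1) *: 'X.
Proof.
rewrite comp_polyD comp_polyX comp_polyC; split=> //.
have -> : 2%:R - 1 = 1 :> K by ring.
by rewrite rmorphD /= addrAC.
Qed.

Lemma size_ev2_conic (delta : K) n k (F : {poly {poly K}}) :
  (size F <= k.+1)%N -> (size (swapXY F) <= n.+1)%N ->
  (size (ev2 (@polyC K) 'X ('X + delta%:P) F) <= (n + k).+1)%N.
Proof.
move=> kF nF; apply: (size_ev2_curve kF nF) => i j ni kj.
rewrite (leq_trans (size_polyMleq _ _)) // size_polyXn.
rewrite (leq_trans (n := (i.+1 + j.+1).-1)) //; last by lia.
have /= := size_poly_exp_leq ('X + delta%:P) j.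
by rewrite size_XaddC mul1n; lia.
Qed.

End Graphs.

(** * Removing a ruling or a conic *)

Section Steps.
Variables (K : fieldType) (r : nat) (x y : 'I_r -> K).
Hypothesis two_neq0 : 2%:R != 0 :> K.
Local Notation biforms := (biforms x y).
Local Notation dim_le := (dim_le (@polyC K)).

Lemma line_y_step n k m i0 N : injective x -> injective y ->
  dim_le (biforms n k (fun i => m i - (i == i0))%N) N ->
  dim_le (biforms n k.+1 m) ((n - m i0) + N).
Proof.
move=> xI yI; have -> : m i0 = \sum_(i | pred1 i0 i) m i by rewrite big_pred1_eq.
(* The horizontal direction is [s = 2] in the family [(s, 2 - s)], so the parameter runs at speed
   [c = 2]; the vertical one, [s = 0], has the same speed. *)
apply: (@curve_step _ _ _ _ _ _ _ _ _ _ (pred1 i0) x 'X (y i0)%:P 2%:R 2%:R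
  ('X - (y i0)%:P%:P)) => //.
- move=> F kF nF; apply: (size_ev2_curve kF nF) => i j ni _.
  rewrite -rmorphXn mulrC mul_polyC (leq_trans (size_scale_leq _ _)) //.
  by rewrite size_polyXn.
- move=> F kF nF F0; rewrite -[n]addn0 in nF.
  exact: graph_factor (size_swap_XsubC (y i0)) kF nF F0.
- by move=> i j _ _; apply: xI.
- move=> i /eqP ->; rewrite comp_polyX comp_polyC subrr scale0r addr0.
  by split.
move=> i; rewrite /simple_at; set e' := ev2 _ _ _ _.
have -> : e' = ((y i - y i0)%:P)%:P + (2%:R - 'X)%:P * 'X.
  rewrite /e' ev2_XsubC ev1C.
  rewrite -[polyC2 K (y i0)]/((y i0)%:P%:P) !polyCB; ring.
rewrite !coef_affine /=; case: eqP => [->|/eqP ii].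
  rewrite subrr; split=> //; rewrite -polyC_natr.
  have := @affine_neq0 K 2%:R (-1); rewrite scaleN1r; apply.
  by rewrite two_neq0.
by rewrite polyC_eq0 subr_eq0; apply: contra ii => /eqP/yI ->.
Qed.

Lemma line_x_step n k m i0 N : injective x -> injective y ->
  dim_le (biforms n k (fun i => m i - (i == i0))%N) N ->
  dim_le (biforms n.+1 k m) ((k - m i0) + N).
Proof.
move=> xI yI; have -> : m i0 = \sum_(i | pred1 i0 i) m i by rewrite big_pred1_eq.
apply: (@curve_step _ _ _ _ _ _ _ _ _ _ (pred1 i0) y (x i0)%:P 'X 0 2%:R
  ('X - (x i0)%:P)%:P) => //.
- move=> F kF nF; apply: (size_ev2_curve kF nF) => i j _ kj.
  rewrite -rmorphXn mul_polyC (leq_trans (size_scale_leq _ _)) //.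
  by rewrite size_polyXn.
- move=> F kF nF; rewrite -ev2_swap => F0.
  have kF' : (size (swapXY (swapXY F)) <= k + 0)%N by rewrite swapXYK addn0.
  have [G [E nG kG]] := graph_factor (size_swap_XsubC (x i0)) nF kF' F0.
  exists (swapXY G); split=> //; last by rewrite swapXYK.
  rewrite -[F]swapXYK E rmorphM rmorphB /= swapXY_X swapXY_polyC map_polyC.
  by rewrite -rmorphB.
- by move=> i j _ _; apply: yI.
- move=> i /eqP ->; rewrite comp_polyX comp_polyC subr0 scale0r addr0.
  by split.
move=> i; rewrite /simple_at; set e' := ev2 _ _ _ _.
have -> : e' = ((x i - x i0)%:P)%:P + 'X%:P * 'X.
  rewrite /e' ev2C ev1_XsubC.
  rewrite -[polyC2 K (x i0)]/((x i0)%:P%:P) !polyCB; ring.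
rewrite !coef_affine /=; case: eqP => [->|/eqP ii].
  by rewrite subrr polyX_eq0.
by rewrite polyC_eq0 subr_eq0; apply: contra ii => /eqP/xI ->.
Qed.

(** Along the generic direction the equation has slope [2 - 2 'X], a nonzero polynomial although it
    vanishes at the tangent direction ['X = 1]. *)
Lemma simple_at_conic (u v delta : K) :
  simple_at (v == u + delta) u v ('X - ('X + delta%:P)%:P).
Proof.
rewrite /simple_at; set e' := ev2 _ _ _ _.
have -> : e' = ((v - (u + delta))%:P)%:P + (2%:R - 'X - 'X)%:P * 'X.
  rewrite /e' ev2_XsubC ev1_XaddC.
  rewrite -[polyC2 K delta]/(delta%:P%:P) !polyCB !polyCD; ring.
rewrite !coef_affine /=; case: eqP => [->|/eqP ii].
  rewrite subrr; split=> //; rewrite -polyC_natr -addrA -opprD -mulr2n.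
  by rewrite -scaler_nat -scaleNr affine_neq0 // two_neq0.
by rewrite polyC_eq0 subr_eq0.
Qed.

Lemma conic_step n k m (delta : K) N : injective x ->
  dim_le (biforms n k (fun i => m i - (y i == (x i + delta)%R))%N) N ->
  dim_le (biforms n.+1 k.+1 m)
    (((n + k).+1 - \sum_(i | y i == (x i + delta)%R) m i) + N).
Proof.
move=> xI; apply: (@curve_step _ _ _ _ _ _ _ _ _ _
   (fun i => y i == x i + delta) x 'X ('X + delta%:P) 1 1
  ('X - ('X + delta%:P)%:P)) => //.
- by rewrite oner_eq0.
- by move=> F; apply: size_ev2_conic.
- by move=> F; apply: conic_factor.
- by move=> i j _ _; apply: xI.
- by move=> i /eqP ->; apply: conic_arc.
by move=> i; apply: simple_at_conic.
Qed.
End Steps.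

(** * Gluing sections on the two tangent conics *)

Section Glue.
Variables (K : fieldType) (r : nat) (x y : 'I_r -> K).
Hypothesis char0 : [pchar K] =i pred0.
Local Notation biforms := (biforms x y).
Local Notation dim_le := (dim_le (@polyC K)).

Lemma monic_prod_XsubC_exp (on : pred 'I_r) (z : 'I_r -> K) (m : 'I_r -> nat) :
  \prod_(i | on i) ('X - (z i)%:P) ^+ m i \is monic.
Proof. by apply: monic_prod => i _; rewrite monic_exp // monicXsubC. Qed.

(** Vieta's formula, for the list [ps] of the roots repeated with multiplicity. *)
Lemma coef_prod_XsubC_exp (on : pred 'I_r) (z : 'I_r -> K) (m : 'I_r -> nat) s :
  (\sum_(i | on i) m i)%N = s.+1 ->
  (\prod_(i | on i) ('X - (z i)%:P) ^+ m i)`_s = - \sum_(i | on i) z i *+ m i.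
Proof.
pose ps := flatten [seq nseq (m i) (z i) | i <- index_enum 'I_r & on i].
have -> : \prod_(i | on i) ('X - (z i)%:P) ^+ m i = \prod_(p <- ps) ('X - p%:P).
  rewrite big_flatten big_map big_filter; apply: eq_bigr => i _.
  by rewrite big_nseq iter_mulr_1.
have -> : \sum_(i | on i) z i *+ m i = \sum_(p <- ps) p.
  rewrite big_flatten big_map big_filter; apply: eq_bigr => i _.
  by rewrite big_nseq iter_addr_0.
have -> : (\sum_(i | on i) m i)%N = size ps.
  rewrite size_flatten /shape -map_comp sumnE big_map big_filter.
  by apply: eq_bigr => i _; rewrite /= size_nseq.
by move=> sz; rewrite -[s]/(s.+1.-1) -sz coefPn_prod_XsubC // sz.
Qed.

Lemma coef_XaddC1_exp j k : (('X + 1%:P : {poly K}) ^+ j)`_k = 'C(j, k)%:R.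
Proof.
rewrite exprD1n coef_sum; case: (ltnP k j.+1) => kj.
  rewrite (bigD1 (Ordinal kj)) //= coefMn coefXn eqxx big1 ?addr0 // => i ik.
  by rewrite coefMn coefXn (negPf (_ : k != i)) ?mul0rn // eq_sym.
rewrite bin_small // big1 // => i _; rewrite coefMn coefXn.
by rewrite (negPf (_ : k != i)) ?mul0rn // neq_ltn (leq_trans (ltn_ord i) kj) orbT.
Qed.

Lemma coef_shift_diff d k (F : {poly {poly K}}) : (d <= k)%N ->
  (size F <= d.+1)%N -> (size (swapXY F) <= d.+1)%N ->
  (ev2 (@polyC K) 'X ('X + 1%:P) F - ev2 (@polyC K) 'X 'X F)`_k =
  \sum_(j < d.+1) \sum_(i < d.+1) F`_j`_i *
     ('C(j, k - i)%:R - (k - i == j)%N%:R).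
Proof.
move=> dk kF nF; rewrite !(ev2E _ _ _ kF nF) -sumrB coef_sum.
apply: eq_bigr => j _; rewrite -sumrB coef_sum; apply: eq_bigr => i _.
rewrite -mulrBr -mulrA coefCM coefXnM ltnNge.
rewrite (leq_trans _ dk) ?(leq_ord i) //= coefB coef_XaddC1_exp coefXn.
by [].
Qed.

(** [x^i ((x + 1)^j - x^j)] has degree below [i + j], with coefficient [j] at [i + j - 1]; degree
    [2d - 1] is reached by [i = j = d] alone. *)
Lemma coef_shift_diff_top d (F : {poly {poly K}}) : (0 < d)%N ->
  (size F <= d.+1)%N -> (size (swapXY F) <= d.+1)%N ->
  let H := ev2 (@polyC K) 'X ('X + 1%:P) F - ev2 (@polyC K) 'X 'X F in
  H`_(d + d) = 0 /\ H`_((d + d).-1) = F`_d`_d *+ d.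
Proof.
move=> d0 kF nF H; rewrite /H !(coef_shift_diff _ kF nF); try lia; split.
  apply: big1 => j _; apply: big1 => i _.
  have := leq_ord i; have := leq_ord j; case: eqP => [->|ne] ij ii.
    by rewrite binn subrr mulr0.
  by rewrite bin_small ?subrr ?mulr0 //; lia.
rewrite big_ord_recr /= [X in _ + X]big_ord_recr /= big1 ?add0r => [|j _]; last first.
  apply: big1 => i _; have := leq_ord i; have := ltn_ord j; case: eqP => [->|ne] ij ii.
    by rewrite binn subrr mulr0.
  by rewrite bin_small ?subrr ?mulr0 //; lia.
rewrite big1 ?add0r => [|i _]; last first.
  have := ltn_ord i; case: eqP => [->|ne] ii.
    by rewrite binn subrr mulr0.
  by rewrite bin_small ?subrr ?mulr0 //; lia.
have -> : ((d + d).-1 - d = d.-1)%N by lia.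
rewrite (negPf (_ : d.-1 != d)) ?subr0; last by lia.
by rewrite -bin_sub ?leq_pred // (_ : (d - d.-1 = 1)%N) ?bin1 ?mulr_natr //; lia.
Qed.

Lemma coef_diagonal_top d (F : {poly {poly K}}) :
  (size F <= d.+1)%N -> (size (swapXY F) <= d.+1)%N ->
  (ev2 (@polyC K) 'X 'X F)`_(d + d) = F`_d`_d.
Proof.
move=> kF nF; rewrite (ev2E _ _ _ kF nF) coef_sum big_ord_recr /=.
rewrite big1 ?add0r => [|j _].
  rewrite coef_sum big_ord_recr /= big1 ?add0r => [|i _].
    by rewrite -mulrA -exprD coefCM coefXn eqxx mulr1.
  rewrite -mulrA -exprD coefCM coefXn (negPf (_ : (d + d)%N != _)) ?mulr0 //.
  by have := ltn_ord i; lia.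
rewrite coef_sum big1 // => i _; rewrite -mulrA -exprD coefCM coefXn.
rewrite (negPf (_ : (d + d)%N != _)) ?mulr0 //.
by have := ltn_ord i; have := ltn_ord j; lia.
Qed.

Lemma dvdp_monic_size (p q : {poly K}) s :
  q \is monic -> size q = s.+1 -> (size p <= s.+1)%N -> q %| p ->
  p = p`_s *: q.
Proof.
move=> mq sq sp /dvdpP [t E].
have q0 : q != 0 by apply: monic_neq0.
have st : (size t <= 1)%N.
  have [->|t0] := eqVneq t 0; first by rewrite size_poly0.
  move: sp; rewrite E size_mul // sq addnS /= -[s.+1]add1n.
  by rewrite leq_add2r.
rewrite E (size1_polyC st) mul_polyC coefZ.
have /eqP : lead_coef q = 1 by apply/eqP.
by rewrite lead_coefE sq /= => /eqP ->; rewrite mulr1.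
Qed.

(* If a section does not vanish on the two tangent conics [y = x] and
   [y = x + 1], its restrictions are both determined by their zeros up to one
   common scalar; comparing the next coefficients forces a relation between the
   abscissas of the points. *)
Lemma glue_vanish m (F : {poly {poly K}}) (d := (2 * m)%N) :
  injective x -> (0 < m)%N ->
  (\sum_(i | y i == (x i + 0)%R) m = d + d)%N ->
  (\sum_(i | y i == (x i + 1)%R) m = d + d)%N ->
  \sum_(i | y i == x i + 0) x i - \sum_(i | y i == x i + 1) x i != 2%:R ->
  biforms d.+1 d.+1 (fun=> m) F ->
  ev2 (@polyC K) 'X 'X F = 0 /\ ev2 (@polyC K) 'X ('X + 1%:P) F = 0.
Proof.
move=> xI m0 sA sB hx [kF nF vF].
have d0 : (0 < d)%N by rewrite /d; lia.
have E (delta : K) : (\sum_(i | y i == (x i + delta)%R) m = d + d)%N ->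
    exists c, [/\ ev2 (@polyC K) 'X ('X + delta%:P) F =
      c *: \prod_(i | y i == x i + delta) ('X - (x i)%:P) ^+ m,
      (ev2 (@polyC K) 'X ('X + delta%:P) F)`_(d + d) = c &
      (ev2 (@polyC K) 'X ('X + delta%:P) F)`_((d + d).-1) =
        - c * m%:R * \sum_(i | y i == x i + delta) x i].
  move=> sD; have mon := monic_prod_XsubC_exp (fun i => y i == x i + delta) x (fun=> m).
  have sQ := size_prod_XsubC_exp (fun i => y i == x i + delta) x (fun=> m).
  rewrite sD in sQ; have div : \prod_(i | y i == x i + delta) ('X - (x i)%:P) ^+ m
      %| ev2 (@polyC K) 'X ('X + delta%:P) F.
    apply: dvdp_prod_XsubC_exp => [i j _ _|i /eqP yi]; first exact: xI.
    have [Ea Eb] := conic_arc (x i) delta; apply: vanish_curve (oner_neq0 _) Ea Eb _.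
    by rewrite -yi; apply: vF.
  have EP := dvdp_monic_size mon sQ (size_ev2_conic delta kF nF) div.
  exists (ev2 (@polyC K) 'X ('X + delta%:P) F)`_(d + d); split=> //.
  rewrite [in LHS]EP coefZ coef_prod_XsubC_exp; last by rewrite sD prednK //; lia.
  rewrite sumrMnl -mulr_natr; move: (\sum_(_ | _) _) (_`_(d + d)) => u v.
  ring.
have [c0 [EA A1 A2]] := E 0 sA; have [c1 [EB B1 B2]] := E 1 sB.
rewrite addr0 in EA A1 A2; have [H1 H2] := coef_shift_diff_top d0 kF nF.
have c01 : c1 = c0 by apply/eqP; rewrite -subr_eq0 -A1 -B1 -coefB H1.
have c00 : c0 = 0; last first.
  by rewrite EA EB c01 c00 !scale0r.
have dE : F`_d`_d = c0 by rewrite -A1 coef_diagonal_top.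
(* As [d = 2 m], the difference of the two restrictions has coefficient [2 m c0] in degree [2d - 1];
   this is the origin of the [2] excluded by [hx]. *)
move: H2; rewrite coefB A2 B2 c01 dE => /eqP; rewrite -subr_eq0.
have -> : - c0 * m%:R * (\sum_(i | y i == x i + 1) x i) -
   - c0 * m%:R * (\sum_(i | y i == x i + 0) x i) - c0 *+ d =
   c0 * (m%:R * (\sum_(i | y i == x i + 0) x i - \sum_(i | y i == x i + 1) x i - 2%:R)).
  by rewrite -[c0 *+ _]mulr_natr /d natrM; ring.
rewrite mulf_eq0 => /orP[/eqP //|]; rewrite mulf_eq0 subr_eq0 (negPf hx) orbF.
by move/pcharf0P: char0 => ->; rewrite gtn_eqF.
Qed.

(** The multiplicities sum to [2d] on each conic, so the expected cost is [1 + (-1) = 0], whereas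
    two uses of [conic_step], with truncated subtraction, would charge 1. Removing both conics at
    once avoids the loss. *)
Lemma glue_step m N (d := (2 * m)%N) :
  injective x -> (0 < m)%N ->
  (\sum_(i | y i == (x i + 0)%R) m = d + d)%N ->
  (\sum_(i | y i == (x i + 1)%R) m = d + d)%N ->
  (forall i, (y i == x i + 0) || (y i == x i + 1)) ->
  \sum_(i | y i == x i + 0) x i - \sum_(i | y i == x i + 1) x i != 2%:R ->
  dim_le (biforms d.-1 d.-1 (fun=> m.-1)) N ->
  dim_le (biforms d.+1 d.+1 (fun=> m)) N.
Proof.
move=> xI m0 sA sB on hx; rewrite -[N in X in _ -> X]add0n.
have two : 2%:R != 0 :> K by move/pcharf0P: char0 => ->.
pose e0 : {poly {poly K}} := 'X - ('X + 0%:P)%:P.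
pose e1 : {poly {poly K}} := 'X - ('X + 1%:P)%:P.
have d0 : (0 < d)%N by rewrite /d; lia.
(* Rank-nullity with the zero map: every section vanishes on both conics, so only the description of
   the kernel has content. *)
apply: (@dim_le_step _ _ _ _ _ K^o (idfun : {rmorphism K -> K}) _ _ _ _
    (fun v => v = 0) _ _ _ (fun=> 0) (fun G => e0 * (e1 * G))) => //.
- exact: biforms_subspace.
- by move=> c u v; rewrite scaler0 addr0.
- by move=> t u v; rewrite !mulrDr -!mul_polyC; ring.
- move=> F sF _; have [F0 F1] := glue_vanish xI m0 sA sB hx sF.
  case: sF => kF nF vF.
  have [|G0 [EF kG0 nG0]] := @conic_factor _ 0 d d F kF nF; first by rewrite addr0.
  have G01 : ev2 (@polyC K) 'X ('X + 1%:P) G0 = 0.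
    move: F1; rewrite EF rmorphM /= ev2_XsubC ev1_XaddC.
    by rewrite rmorph0 addr0 addrAC subrr add0r rmorph1 mul1r.
  rewrite -[d](prednK d0) in kG0 nG0.
  have [G [EG kG nG]] := conic_factor kG0 nG0 G01.
  exists G; last by rewrite EF EG.
  split=> // i; have := vF i; rewrite EF EG.
  move=> /(vanish_cancel (simple_at_conic two (x i) (y i) 0)).
  move=> /(vanish_cancel (simple_at_conic two (x i) (y i) 1)).
  rewrite -subnDA; have := on i; case: eqP => [->|_] /=; last by move=> -> /=; rewrite add0n subn1.
  rewrite (inj_eq (addrI _)) eq_sym oner_eq0 addn0 subn1; done.
- exact: dim_le0.
Qed.
End Glue.

(** * Systems on the quadric exhausted by rulings *)

Section Lines.
Variables (K : fieldType) (r : nat) (x y : 'I_r -> K).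
Hypothesis two_neq0 : 2%:R != 0 :> K.
Local Notation biforms := (biforms x y).
Local Notation dim_le := (dim_le (@polyC K)).

Lemma dim_le_biforms n k m : dim_le (biforms n k m) (n * k).
Proof.
have lt (j : 'I_(n * k)) : (j %% k < k)%N.
  by rewrite ltn_mod; case: k j => //; rewrite muln0 => -[].
apply: (@dim_le_coord _ _ _ _ _ _ (fun (j : 'I_(n * k)) (F : {poly {poly K}}) => F`_(j %% k)`_(j %/ k))).
- exact: biforms_subspace.
- by move=> j c u v; rewrite coefD coefZ coefD coefCM.
move=> F [kF nF _] H; apply/polyP => j; apply/polyP => i; rewrite !coef0.
case: (ltnP j k) => jk; last by rewrite [F`_j]nth_default ?coef0 // (leq_trans kF).
case: (ltnP i n) => ni; last first.
  by rewrite -coef_swapXY [(swapXY F)`_i]nth_default ?coef0 // (leq_trans nF).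
have lt_ij : (i * k + j < n * k)%N by nia.
have := H (Ordinal lt_ij); rewrite /= modnMDl modn_small // divnMDl; last by lia.
by rewrite divn_small // addn0.
Qed.

Lemma sum_lower (m : 'I_r -> nat) i0 : (0 < m i0)%N ->
  (\sum_i (m i - (i == i0)) + 1 = \sum_i m i)%N.
Proof.
move=> m0; rewrite (bigD1 i0) //= [RHS](bigD1 i0) //= eqxx.
rewrite (eq_bigr m) => [|i /negPf ->]; last by rewrite subn0.
by rewrite subn1 addn1 -addSn prednK.
Qed.

Lemma sum_binS_lower (m : 'I_r -> nat) i0 :
  (\sum_i 'C((m i - (i == i0)).+1, 2) + m i0 = \sum_i 'C((m i).+1, 2))%N.
Proof.
rewrite (bigD1 i0) //= [RHS](bigD1 i0) //= eqxx.
rewrite [X in (_ + X + _)%N](eq_bigr (fun i => 'C((m i).+1, 2))) => [|i /negPf ->].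
  rewrite addnAC; congr (_ + _)%N; case: (m i0) => // t.
  by rewrite subn1 /= [RHS]binS bin1.
by rewrite subn0.
Qed.

(** Induction on [n + k], removing a ruling through a point [i0] of largest multiplicity, in the
    direction that shrinks the larger of [n] and [k]. The bounds [m i <= n, k] survive: for
    [i != i0] one has [2 m i <= m i + m i0 < n + k], so [m i] lies strictly below the larger one.
    They also keep each subtraction exact. *)
Lemma lines_bound n k m : injective x -> injective y ->
  (forall i, (m i <= n)%N /\ (m i <= k)%N) -> (\sum_i m i <= (n + k).-1)%N ->
  exists N, (N + \sum_i 'C((m i).+1, 2) = n * k)%N /\ dim_le (biforms n k m) N.
Proof.
move=> xI yI; move: {2}(n + k)%N (leqnn (n + k)) => s.
elim: s n k m => [|s IH] n k m le_s mle sle.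
  exists (n * k)%N; split; last exact: dim_le_biforms.
  rewrite big1 ?addn0 // => i _; have [h _] := mle i.
  by have -> : m i = 0%N by lia.
case: (boolP [forall i, m i == 0%N]) => [/forallP m0|].
  exists (n * k)%N; split; last exact: dim_le_biforms.
  by rewrite big1 ?addn0 // => i _; rewrite (eqP (m0 i)).
rewrite negb_forall => /existsP [i1 mi1].
have [i0 _ max0] := @arg_maxnP _ i1 xpredT m isT.
have m0 : (0 < m i0)%N by apply: leq_trans (max0 i1 isT); rewrite lt0n.
have [le1 le2] := mle i0; have sl := sum_lower m0; have sC := sum_binS_lower m i0.
have two i : i != i0 -> (m i + m i0 <= (n + k).-1)%N.
  move=> ne; apply: leq_trans sle; rewrite (bigD1 i0) //= (bigD1 i) //=.
  by rewrite addnCA addnA leq_addr.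
have bound i (a b : nat) : (a <= b)%N -> (n + k = a + b)%N -> (m i <= a)%N ->
    (m i <= b)%N -> (m i - (i == i0) <= b.-1)%N.
  move=> ab E ma mb; have [->|ne] := eqVneq i i0; first by lia.
  by have := two i ne; have := max0 i isT; rewrite subn0; lia.
case: (leqP k n) => kn.
  case: n => [|n] in mle sle le_s le1 two bound kn *; first by lia.
  have [|||N [EN HN]] := IH n k (fun i => m i - (i == i0))%N; try lia.
    move=> i; have [h1 h2] := mle i.
    by have := bound i k n.+1 kn (addnC _ _) h2 h1; lia.
  exists ((k - m i0) + N)%N; split; first by nia.
  exact: line_x_step.
case: k => [|k] in mle sle le_s le2 two bound kn *; first by lia.
have [|||N [EN HN]] := IH n k (fun i => m i - (i == i0))%N; try lia.
  move=> i; have [h1 h2] := mle i.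
  by have := bound i n k.+1 (ltnW kn) erefl h1 h2; lia.
exists ((n - m i0) + N)%N; split; first by nia.
exact: line_y_step.
Qed.
End Lines.

Lemma sum_ord8 (F : nat -> nat) (P : pred nat) :
  (\sum_(i < 8 | P i) F i = \sum_(i <- iota 0 8 | P i) F i)%N.
Proof. by rewrite -(big_mkord P F). Qed.

(** * Eight points of the quadric on two tangent conics *)

Section Quadric.
Variables (K : fieldType) (x y : 'I_8 -> K).
Hypothesis char0 : [pchar K] =i pred0.
Hypothesis (xI : injective x) (yI : injective y).
Hypothesis on_even : forall i : 'I_8, (y i == x i + 0) = ~~ odd i.
Hypothesis on_odd : forall i : 'I_8, (y i == x i + 1) = odd i.
Hypothesis unbalanced :
  \sum_(i | y i == x i + 0) x i - \sum_(i | y i == x i + 1) x i != 2%:R.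
Local Notation biforms := (biforms x y).
Local Notation dim_le := (dim_le (@polyC K)).

Lemma dim_le_biforms_ext n k (m m' : 'I_8 -> nat) N :
  m =1 m' -> dim_le (biforms n k m) N -> dim_le (biforms n k m') N.
Proof.
move=> E; apply: dim_le_sub => F [kF nF vF]; split=> // i.
by rewrite E; apply: vF.
Qed.

(* Remove the two conics in turn; the rulings through the first point are
   removed when its multiplicity exceeds the degree. *)
Lemma quadric_bound d (m : nat -> nat) :
  (forall i j, (i <= j)%N -> (m j <= m i)%N) -> (m 0 <= d.+1)%N ->
  (m 0 + m 1 + m 2 + m 3 <= 2 * d)%N ->
  exists N, (N + \sum_(i < 8) 'C((m i).+1, 2) = d.+1 * d.+1)%N /\
    dim_le (biforms d.+1 d.+1 (fun i => m i)) N.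
Proof.
have two : 2%:R != 0 :> K by move/pcharf0P: char0 => ->.
elim/ltn_ind: d m => d IH m mono m0 std.
have m_ i := mono i i.+1 (leqnSn i).
have := (m_ 0, m_ 1, m_ 2, m_ 3)%N => -[[[m10 m21] m32] m43].
have := (m_ 4, m_ 5, m_ 6)%N => -[[m54 m65] m76].
have [m3|m3] := posnP (m 3%N).
  apply: (lines_bound two xI yI) => [i|].
    by have h := mono 0%N i isT; rewrite !(leq_trans h).
  by rewrite (sum_ord8 m xpredT) /= !big_cons big_nil; lia.
have binE t : ('C(t.-1.+1, 2) + t = 'C(t.+1, 2))%N.
  by case: t => // t; rewrite [RHS]binS bin1.
(* When [m 0 = d + 1] both rulings through the first point are fixed components: each is removed at
   cost zero, and together they lower [m 0] by two and the bidegree by [(1, 1)]. *)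
have [m0d|m0d] := eqVneq (m 0%N) d.+1.
  case: d => [|d] in IH m0 std m0d *; first by lia.
  have [|i j ij|||N [EN HN]] := IH d _ (fun i => if i == 0 then d else m i)%N => //.
  - case: i ij => [|i] /=; case: j => [|j] //= ij; last exact: mono.
    by have := mono 1%N j.+1 isT; lia.
  - by rewrite /=; lia.
  exists N; split; last first.
    have st := @line_x_step _ _ x y two d.+1 d.+2 (fun i : 'I_8 => m i) ord0 N xI yI.
    rewrite m0d subnn add0n in st; apply: st.
    have st := @line_y_step _ _ x y two d.+1 d.+1
      (fun i : 'I_8 => m i - (i == ord0))%N ord0 N xI yI.
    rewrite m0d eqxx subn1 subnn add0n in st; apply: st.
    apply: dim_le_biforms_ext HN => i; rewrite -val_eqE /=.
    by case: eqP => [->|_]; lia.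
  move: EN; rewrite (sum_ord8 (fun i => 'C((m i).+1, 2)) xpredT).
  rewrite (sum_ord8 (fun i => 'C((if i == 0 then d else m i).+1, 2)) xpredT).
  rewrite /= !big_cons !big_nil /=.
  have h1 : ('C(d.+3, 2) = 'C(d.+2, 2) + d.+2)%N by rewrite binS bin1.
  have h2 : ('C(d.+2, 2) = 'C(d.+1, 2) + d.+1)%N by rewrite binS bin1.
  rewrite m0d h1 h2; lia.
case: d => [|[|d]] in IH m0 std m0d *; [lia | lia |].
have [||||N [EN HN]] := IH d _ (fun i => (m i).-1); try lia.
  by move=> i j /mono; lia.
have sA : (\sum_(i | y i == (x i + 0)%R) m i = m 0%N + m 2%N + m 4%N + m 6%N)%N.
  rewrite (eq_bigl _ _ on_even) (sum_ord8 m (fun i => ~~ odd i)).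
  by rewrite /= !big_cons big_nil /=; lia.
have sB : (\sum_(i | y i == (x i + 1)%R) m i = m 1%N + m 3%N + m 5%N + m 7%N)%N.
  rewrite (eq_bigl _ _ on_odd) (sum_ord8 m odd).
  by rewrite /= !big_cons big_nil /=; lia.
have sC : (\sum_(i < 8) 'C((m i).+1, 2) =
  \sum_(i < 8) 'C((m i).-1.+1, 2) + (m 0%N + m 1%N + m 2%N + m 3%N + m 4%N + m 5%N + m 6%N + m 7%N))%N.
  rewrite (eq_bigr (fun i : 'I_8 => 'C((m i).-1.+1, 2) + m i)%N) => [|i _]; last first.
    by rewrite binE.
  rewrite big_split /=; congr (_ + _)%N.
  by rewrite (sum_ord8 m xpredT) /= !big_cons big_nil; lia.
have [sB'|sB'] := leqP (2 * d.+2)%N (m 1%N + m 3%N + m 5%N + m 7%N).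
  (* The odd sum is at least twice the degree, the first four multiplicities sum to at most that,
     and the order is decreasing; so all eight are equal. *)
  have E i : (i < 8)%N -> m i = m 3%N /\ d.+2 = (2 * m 3%N)%N.
    by do 8?[case: i => [|i]] => //; lia.
  have := glue_step char0 (m := m 3%N) (N := N) xI m3 _ _ _ unbalanced.
  have dE := proj2 (E 0%N isT); rewrite -dE => st.
  exists N; split; first by rewrite sC; lia.
  apply: (@dim_le_biforms_ext _ _ (fun=> m 3%N)) => [i|].
    by have [->] := E i (ltn_ord i).
  apply: st => [||i|].
  - rewrite (eq_bigr (fun i : 'I_8 => m i)) => [|i _]; last by have [->] := E i (ltn_ord i).
    by rewrite sA; lia.
  - rewrite (eq_bigr (fun i : 'I_8 => m i)) => [|i _]; last by have [->] := E i (ltn_ord i).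
    by rewrite sB; lia.
  - by rewrite on_even on_odd orNb.
  - by apply: dim_le_biforms_ext HN => i; have [->] := E i (ltn_ord i).
exists ((d.+2 + d.+2).+1 - (m 0%N + m 2%N + m 4%N + m 6%N) +
        ((d.+1 + d.+1).+1 - (m 1%N + m 3%N + m 5%N + m 7%N) + N))%N.
split; first by rewrite sC; nia.
rewrite -sA; apply: (conic_step two) => //.
have -> : (m 1%N + m 3%N + m 5%N + m 7%N =
    \sum_(i | y i == (x i + 1)%R) (m i - (y i == (x i + 0)%R)))%N.
  rewrite -sB; apply: eq_bigr => i; rewrite on_odd on_even => ->.
  by rewrite subn0.
apply: (conic_step two) => //.
apply: dim_le_biforms_ext HN => i; rewrite on_odd on_even.
by case: (odd i); rewrite /= ?subn0 subn1.
Qed.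
End Quadric.

(** * Multiplicity at a point of affine space *)

Section Hasse.
Variables (n : nat) (K : fieldType).
Implicit Types (v : 'I_n -> K) (f g : {mpoly K[n]}) (b : 'I_n -> nat).

(** The Hasse, or divided-power, derivative of order [b] at [v]: the coefficient of [w^b] in
    [f(v + w)]. Where [u j < b j] the binomial is 0, so the truncated exponent is harmless. *)
Definition hasse b v f : K :=
  \sum_(u <- msupp f) f@_u * \prod_(j < n) ('C(u j, b j)%:R * v j ^+ (u j - b j)).

Definition vanish_to (m : nat) v f : Prop :=
  forall b, (\sum_j b j < m)%N -> hasse b v f = 0.

Lemma hasseE b v f N : (msize f <= N)%N ->
  hasse b v f = \sum_(u : 'X_{1..n < N})
    f@_u * \prod_(j < n) ('C(u j, b j)%:R * v j ^+ (u j - b j)).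
Proof.
move=> le_fN; rewrite /hasse (big_mksub ('X_{1..n < N} : subFinType _)) ?msupp_uniq //=.
  by rewrite big_rmcond //= => j /memN_msupp_eq0 ->; rewrite mul0r.
by move=> u /msize_mdeg_lt /leq_trans; apply.
Qed.

Lemma hasseZD b v c f g : hasse b v (c *: f + g) = c * hasse b v f + hasse b v g.
Proof.
pose N := maxn (msize (c *: f + g)) (maxn (msize f) (msize g)).
rewrite !(@hasseE _ _ _ N) ?leq_max ?leqnn ?orbT // mulr_sumr -big_split.
by apply: eq_bigr => u _; rewrite mcoeffD mcoeffZ mulrDl mulrA.
Qed.

Lemma hasse0 b v : hasse b v 0 = 0.
Proof. by rewrite /hasse msupp0 big_nil. Qed.

Lemma vanish_to_subspace m v : subspace idfun (vanish_to m v).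
Proof.
split=> [b _|c f g vf vg b bm]; first exact: hasse0.
by rewrite hasseZD vf // vg // mulr0 addr0.
Qed.

Lemma mmap_comp (A B : comNzRingType) (iota : {rmorphism K -> A})
    (g : {rmorphism A -> B}) (kappa : {rmorphism K -> B}) (w : 'I_n -> A) f :
  g \o iota =1 kappa -> g (mmap iota w f) = mmap kappa (g \o w) f.
Proof.
move=> E; rewrite /mmap rmorph_sum; apply: eq_bigr => u _.
rewrite rmorphM -[kappa _]E; congr (_ * _); rewrite /mmap1 rmorph_prod.
by apply: eq_bigr => i _; rewrite rmorphXn.
Qed.

Lemma mpoly_id f : mmap (@mpolyC n K) (fun i => 'X_i) f = f.
Proof.
rewrite [RHS]mpolyE; apply: eq_bigr => u _.
by rewrite mmap1_id mul_mpolyC.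
Qed.

Lemma taylor (A : comNzRingType) (iota : {rmorphism K -> A}) v (w : 'I_n -> A)
    N f : (forall u, u \in msupp f -> forall j, (u j < N)%N) ->
  mmap iota (fun j => iota (v j) + w j) f =
  \sum_(b : {ffun 'I_n -> 'I_N}) iota (hasse (fun j => b j) v f) * \prod_j w j ^+ b j.
Proof.
move=> ltN; rewrite /mmap big_seq.
under eq_bigr => u su.
  have -> : mmap1 (fun j => iota (v j) + w j) u = \sum_(b : {ffun 'I_n -> 'I_N})
      \prod_j (iota ('C(u j, b j)%:R * v j ^+ (u j - b j)) * w j ^+ b j).
    rewrite -(bigA_distr_bigA (fun j (i : 'I_N) =>
      iota ('C(u j, i)%:R * v j ^+ (u j - i)) * w j ^+ i)); apply: eq_bigr => j _.
    rewrite exprDn (big_ord_widen _ (fun i => (iota (v j) ^+ (u j - i) * w j ^+ i) *+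
       'C(u j, i)) (ltN u su j)) big_mkcond; apply: eq_bigr => i _ /=.
    rewrite rmorphM rmorph_nat rmorphXn; case: ltnP => iu.
      by rewrite -mulr_natl mulrA.
    by rewrite bin_small // mul0r mul0r.
  over.
rewrite -big_seq; under eq_bigr => u _ do rewrite mulr_sumr.
rewrite exchange_big; apply: eq_bigr => b _ /=.
rewrite /hasse rmorph_sum mulr_suml; apply: eq_bigr => u _.
by rewrite big_split /= rmorphM rmorph_prod mulrA.
Qed.

Lemma exists_exp_bound f :
  exists N, forall u, u \in msupp f -> forall j, (u j < N)%N.
Proof.
exists (msize f) => u /msize_mdeg_lt lt_u j; apply: leq_ltn_trans lt_u.
by rewrite mdegE (bigD1 j) //= leq_addr.
Qed.

Lemma vanish_to_arc (D : comNzRingType) (iota : {rmorphism K -> {poly D}}) v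
    (w : 'I_n -> {poly D}) m f : vanish_to m v f ->
  forall k, (k < m)%N -> (mmap iota (fun j => iota (v j) + 'X * w j) f)`_k = 0.
Proof.
move=> vf k km; have [N HN] := exists_exp_bound f.
rewrite (taylor _ _ _ HN) coef_sum big1 // => b _.
case: (ltnP (\sum_j b j) m) => bm; first by rewrite vf // rmorph0 mul0r coef0.
under eq_bigr => j _ do rewrite exprMn.
rewrite big_split /= prodrXr mulrCA coefXnM.
by rewrite (leq_trans km bm).
Qed.

(** The expansion of [f] along a line leaving [v] in a direction with indeterminate coordinates. Its
    coefficients are the homogeneous parts of [f] at [v], so multiplicity becomes order in one
    variable over a domain and is additive on products. *)
Definition generic_arc v f : {poly {mpoly K[n]}} :=
  mmap (polyC \o @mpolyC n K)
    (fun j => (v j)%:MP%:P + 'X * ('X_j)%:P) f.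
HB.instance Definition _ v := GRing.RMorphism.copy (generic_arc v)
  (mmap (polyC \o @mpolyC n K) (fun j => (v j)%:MP%:P + 'X * ('X_j)%:P)).

Lemma generic_arc_vanish m v f :
  (forall k, (k < m)%N -> (generic_arc v f)`_k = 0) <-> vanish_to m v f.
Proof.
split=> [H b bm|vf k km]; last exact: (@vanish_to_arc _ (polyC \o @mpolyC n K) v (fun j => ('X_j)%:P) m f vf).
have [N0 HN0] := exists_exp_bound f.
pose N := (N0 + \sum_j b j).+1.
have HN u : u \in msupp f -> forall j, (u j < N)%N.
  by move=> su j; rewrite (leq_trans (HN0 _ su j)) // /N -addnS leq_addr.
have bN j : (b j < N)%N.
  by rewrite /N ltnS (bigD1 j) //= addnCA leq_addr.
pose b' := [ffun j => Ordinal (bN j)].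
have /(congr1 (mcoeff [multinom b j | j < n])) := H _ bm.
rewrite /generic_arc (@taylor _ (polyC \o @mpolyC n K) v _ N) // mcoeff0.
rewrite coef_sum raddf_sum (bigD1 b') //= [X in _ + X]big1 => [|c cb].
  under eq_bigr => j _ do rewrite exprMn -rmorphXn ffunE.
  rewrite big_split /= prodrXr -rmorph_prod /= mulrCA coefXnM ltnn subnn.
  rewrite coefCM coefC eqxx mcoeffCM.
  have -> : \prod_j ('X_j : {mpoly K[n]}) ^+ b j = 'X_[[multinom b j | j < n]].
    by rewrite mpolyXE_id; apply: eq_bigr => j _; rewrite mnmE.
  rewrite mcoeffX eqxx mulr1 addr0 => <-; apply: eq_bigr => u _.
  by congr (_ * _); apply: eq_bigr => j _; rewrite ffunE.
under eq_bigr => j _ do rewrite exprMn -rmorphXn.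
rewrite big_split /= prodrXr -rmorph_prod /= mulrCA coefXnM.
case: ifP => [_|_]; first by rewrite mcoeff0.
rewrite coefCM coefC; case: eqP => _; last by rewrite mulr0 mcoeff0.
have -> : \prod_j ('X_j : {mpoly K[n]}) ^+ c j = 'X_[[multinom (c j : nat) | j < n]].
  by rewrite mpolyXE_id; apply: eq_bigr => j _; rewrite mnmE.
rewrite mcoeffCM mcoeffX; case: eqP => [/mnmP E|_]; last by rewrite mulr0.
case/eqP: cb; apply/ffunP => j; apply: val_inj; rewrite ffunE /=.
by have := E j; rewrite !mnmE.
Qed.

Lemma vanish_to_cancel m v e f :
  (generic_arc v e)`_0 = 0 -> (generic_arc v e)`_1 != 0 ->
  vanish_to m v (e * f) -> vanish_to m.-1 v f.
Proof.
move=> e0 e1 /generic_arc_vanish H; apply/generic_arc_vanish.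
apply: coef_low_cancel1 e0 e1 _ => k km.
by rewrite -rmorphM H.
Qed.
End Hasse.

(** * Restriction to the quadric *)

Local Notation o0 := (@Ordinal 4 0 isT).
Local Notation o1 := (@Ordinal 4 1 isT).
Local Notation o2 := (@Ordinal 4 2 isT).
Local Notation o3 := (@Ordinal 4 3 isT).

Lemma big_ord4 (R : Type) (idx : R) (op : Monoid.law idx) (F : 'I_4 -> R) :
  \big[op/idx]_(i < 4) F i = op (F o0) (op (F o1) (op (F o2) (F o3))).
Proof.
rewrite !big_ord_recl big_ord0 Monoid.mulm1.
by congr (op _ (op _ (op _ _))); congr F; apply: val_inj.
Qed.

Lemma ord4P (P : 'I_4 -> Prop) : P o0 -> P o1 -> P o2 -> P o3 -> forall i, P i.
Proof.
move=> P0 P1 P2 P3 [[|[|[|[|i]]]] lti] //.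
- by rewrite (bool_irrelevance lti isT).
- by rewrite (bool_irrelevance lti isT).
- by rewrite (bool_irrelevance lti isT).
- by rewrite (bool_irrelevance lti isT).
Qed.

Lemma mdeg4 (u : 'X_{1..4}) : mdeg u = (u o0 + (u o1 + (u o2 + u o3)))%N.
Proof. by rewrite mdegE big_ord4. Qed.

(** The Segre parametrization of the quadric on the chart [X0 = 1]. *)
Definition quad_vec (R : comNzRingType) (x y : R) (j : 'I_4) : R :=
  [:: 1; x; y; x * y]`_j.

Section Theta.
Variable K : fieldType.
Implicit Types (f : {mpoly K[4]}).

Lemma mmap_ext (A : comNzRingType) (iota : {rmorphism K -> A}) n
    (w w' : 'I_n -> A) (f : {mpoly K[n]}) :
  w =1 w' -> mmap iota w f = mmap iota w' f.
Proof. by move=> E; apply: eq_bigr => u _; rewrite (mmap1_eq _ E). Qed.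

(* Restriction to the quadric [X0 X3 = X1 X2], on the chart [X0 = 1]. *)
Definition theta f : {poly {poly K}} :=
  mmap (polyC2 K) (quad_vec 'X%:P 'X) f.

Lemma thetaZD c f g : theta (c *: f + g) = c%:P *: theta f + theta g.
Proof. by rewrite /theta mmapD mmapZ mul_polyC. Qed.

Lemma coef_theta f i j : (theta f)`_j`_i =
  \sum_(u <- msupp f | (u o1 + u o3 == i)%N && (u o2 + u o3 == j)%N) f@_u.
Proof.
rewrite /theta /mmap !coef_sum [RHS]big_mkcond; apply: eq_bigr => u _.
rewrite /mmap1 big_ord4 /quad_vec /= expr1n mul1r exprMn_comm; last exact: mulrC.
have -> : ('X%:P : {poly {poly K}}) ^+ u o1 * ('X ^+ u o2 * ('X%:P ^+ u o3 * 'X ^+ u o3)) =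
   ('X ^+ (u o1 + u o3)%N)%:P * 'X ^+ (u o2 + u o3)%N.
  by rewrite rmorphXn /= !exprD; ring.
rewrite !coefCM coefXn; case: eqP => [->|ne].
  rewrite eqxx andbT mulr1 coefXn; case: eqP => [->|ne]; first by rewrite eqxx mulr1.
  by rewrite mulr0; case: eqP => // E; case: ne; rewrite E.
by rewrite /= mulr0 coef0 mulr0 andbC; case: eqP => // E; case: ne; rewrite E.
Qed.

Lemma size_theta d f : f \is d.-homog ->
  (size (theta f) <= d.+1)%N /\ (size (swapXY (theta f)) <= d.+1)%N.
Proof.
move=> /dhomogP hf.
have H i j : (d < i)%N || (d < j)%N -> (theta f)`_j`_i = 0.
  move=> ij; rewrite coef_theta big_seq_cond big1 // => u /andP[su /andP[/eqP Ei /eqP Ej]].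
  by have : mdeg u = d := hf _ su; rewrite mdeg4; lia.
split; apply/leq_sizeP => j dj; apply/polyP => i; rewrite coef0.
  by rewrite H // dj orbT.
by rewrite coef_swapXY H // dj.
Qed.

Lemma theta_vanish m x y f :
  vanish_to m (quad_vec x y) f -> vanish m x y (theta f).
Proof.
move=> vf k km; rewrite /theta.
set ax := x%:P%:P + _; set ay := y%:P%:P + _.
rewrite (@mmap_comp _ _ _ _ _ (ev2 (polyC2 K) ax ay) (polyC2 K)); last first.
  by move=> c; rewrite /= ev2C ev1C.
(* The Segre map takes the test line to an arc; [w] is this arc minus its base point, divided by the
   parameter. Its last entry is not constant because [x y] is quadratic along the line. *)
pose w (j : 'I_4) : {poly {poly K}} := [:: 0; 'X%:P; (2%:R - 'X)%:P;
  x%:P%:P * (2%:R - 'X)%:P + y%:P%:P * 'X%:P + 'X%:P * (2%:R - 'X)%:P * 'X]`_j.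
rewrite (@mmap_ext _ _ _ _ (fun j => polyC2 K (quad_vec x y j) + 'X * w j)).
  exact: (@vanish_to_arc _ _ _ (polyC2 K) _ w _ _ vf).
apply: ord4P; rewrite /= /quad_vec /w /=.
- by rewrite mulr0 addr0 !rmorph1.
- by rewrite ev2C ev1X mulrC.
- by rewrite ev2X mulrC.
rewrite rmorphM /= ev2C ev1X ev2X /ax /ay.
rewrite !polyCM; ring.
Qed.

Definition quadric : {mpoly K[4]} := 'X_o0 * 'X_o3 - 'X_o1 * 'X_o2.

Lemma quadric_simple x y :
  (generic_arc (quad_vec x y) quadric)`_0 = 0 /\
  (generic_arc (quad_vec x y) quadric)`_1 != 0.
Proof.
have -> : generic_arc (quad_vec x y) quadric =
  ('X_o3 + (x * y)%:MP * 'X_o0 - x%:MP * 'X_o2 - y%:MP * 'X_o1)%:P * 'X +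
  ('X_o0 * 'X_o3 - 'X_o1 * 'X_o2)%:P * 'X ^+ 2.
  rewrite /quadric rmorphB !rmorphM /= /generic_arc !mmapX !mmap1U /quad_vec /=.
  rewrite mpolyCM mpolyC1 !polyCB !polyCD !polyCM; ring.
rewrite !coefD !coefCM !coefX !coefXn /= !mulr0 mulr1 !addr0; split=> //.
apply/eqP => /(congr1 (mcoeff U_(o3))); apply/eqP.
rewrite !mcoeffB mcoeffD !mcoeffCM !mcoeffXU mcoeff0 /= !mulr0 addr0 !subr0.
exact: oner_neq0.
Qed.

(** For [i, j <= d], the only monomial of degree [d] not divisible by [X0 X3] that restricts to
    [x^i y^j]. The truncated subtractions decide which of [X0] and [X3] is absent. *)
Definition normal_mon d i j : 'X_{1..4} :=
  [multinom (nth 0%N [:: d - (i + j); i - (i + j - d); j - (i + j - d); i + j - d]%N (val k)) | k < 4].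

Lemma normal_monP d (u : 'X_{1..4}) : mdeg u = d -> (u o0 == 0%N) || (u o3 == 0%N) ->
  u = normal_mon d (u o1 + u o3) (u o2 + u o3).
Proof.
rewrite mdeg4 => E z; apply/mnmP; apply: ord4P; rewrite mnmE /=; lia.
Qed.

Lemma mon_reduce d (u : 'X_{1..4}) : mdeg u = d ->
  exists2 g : {mpoly K[4]}, g \is (d - 2).-homog &
    'X_[u] = quadric * g + 'X_[normal_mon d (u o1 + u o3) (u o2 + u o3)].
Proof.
move: {2}(u o0) (erefl (u o0)) => k; elim: k u => [|k IH] u uk du.
  exists 0; first exact: rpred0.
  by rewrite mulr0 add0r -normal_monP // uk.
have [u3|u3] := posnP (u o3).
  exists 0; first exact: rpred0.
  by rewrite mulr0 add0r -normal_monP // u3 orbT.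
pose t : 'X_{1..4} := (u - U_(o0) - U_(o3))%MM.
have tE i : u i = (t i + (i == o0) + (i == o3))%N.
  move: i; rewrite /t; apply: ord4P; rewrite !mnmBE !mnm1E /=; lia.
have uE : u = (t + U_(o0) + U_(o3))%MM.
  by apply/mnmP => i; rewrite !mnmDE !mnm1E tE [o0 == _]eq_sym [o3 == _]eq_sym.
have dt : mdeg t = (d - 2)%N by move: du; rewrite uE !mdegD !mdeg1; lia.
pose v : 'X_{1..4} := (t + U_(o1) + U_(o2))%MM.
have v_ i : v i = (t i + (i == o1) + (i == o2))%N.
  by rewrite !mnmDE !mnm1E [o1 == _]eq_sym [o2 == _]eq_sym.
have [||g hg E] := IH v.
- by move: uk; rewrite tE v_ /=; lia.
- by move: du; rewrite uE /v !mdegD !mdeg1.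
exists ('X_[t] + g); first by rewrite rpredD // dhomogX; apply/eqP.
have -> : (u o1 + u o3 = v o1 + v o3)%N by rewrite !tE !v_ /=; lia.
have -> : (u o2 + u o3 = v o2 + v o3)%N by rewrite !tE !v_ /=; lia.
rewrite mulrDr -addrA -E uE /v !mpolyXD /quadric; ring.
Qed.

(** Distinct normal monomials have distinct restrictions, so the remainder of the division by the
    quadric carries the coefficients of [theta f] and vanishes with it. *)
Lemma theta_kernel d f : f \is d.-homog -> theta f = 0 ->
  exists2 g, g \is (d - 2).-homog & f = quadric * g.
Proof.
move=> hf f0; have hu u : u \in msupp f -> mdeg u = d by apply/dhomogP.
pose nf (u : 'X_{1..4}) := normal_mon d (u o1 + u o3) (u o2 + u o3).
suff [g hg E] : exists2 g, g \is (d - 2).-homog &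
    f = quadric * g + \sum_(u <- msupp f) f@_u *: 'X_[nf u].
  exists g => //; rewrite {1}E -[RHS]addr0; congr (_ + _).
  apply/mpolyP => v; rewrite mcoeff0 raddf_sum /=.
  under eq_bigr => u _ do rewrite mcoeffZ mcoeffX.
  case: (boolP (nf v == v)) => [/eqP nv|nv].
    have := coef_theta f (v o1 + v o3) (v o2 + v o3); rewrite f0 !coef0 => S.
    rewrite [RHS]S [RHS]big_mkcond big_seq [RHS]big_seq; apply: eq_bigr => u su.
    have du := hu _ su; rewrite mdeg4 in du.
    case: ifP => [/andP[/eqP E1 /eqP E2]|ne].
      by rewrite /nf E1 E2 -/(nf v) nv eqxx mulr1.
    case: eqP => [E1|_]; last by rewrite mulr0.
    by move: ne; rewrite -E1 !mnmE /=; lia.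
  rewrite big_seq big1 // => u su; case: eqP => [E1|_]; last by rewrite mulr0.
  have du := hu _ su; rewrite mdeg4 in du.
  case/eqP: nv; rewrite /nf -E1; congr normal_mon; rewrite !mnmE /=; lia.
suff [g hg E] : exists2 g, g \is (d - 2).-homog &
    \sum_(u <- msupp f) f@_u *: 'X_[u] =
    quadric * g + \sum_(u <- msupp f) f@_u *: 'X_[nf u].
  by exists g; rewrite // -E -mpolyE.
have : {in msupp f, forall u, mdeg u = d} by [].
elim: (msupp f) => [|u s IH] hs.
  by exists 0; rewrite ?rpred0 // !big_nil mulr0 addr0.
have [|g hg E] := IH; first by move=> v sv; apply: hs; rewrite inE sv orbT.
have [g' hg' E'] := mon_reduce (hs u (mem_head _ _)); exists (f@_u *: g' + g).
  by rewrite rpredD // rpredZ.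
by rewrite !big_cons E E' scalerDr mulrDr -scalerAr; ring.
Qed.
End Theta.

(** * Coordinate systems adapted to four points *)

Definition mons d : seq 'X_{1..4} := [seq s2m t | t : d.-tuple 'I_4 <- enum (basis 4 d)].

Lemma mem_mons d u : (u \in mons d) = (mdeg u == d).
Proof. by rewrite basis_cover. Qed.

Lemma uniq_mons d : uniq (mons d).
Proof. exact: uniq_basis. Qed.

Lemma size_mons d : size (mons d) = 'C(d + 3, 3).
Proof. by rewrite size_basis -bin_sub ?leq_addr // addKn. Qed.

(** Divide by [w]. The form [(d + 3) - mdeg w] makes the binomial vanish when the degree of [w]
    exceeds [d]. *)
Lemma count_shift d (w : 'X_{1..4}) :
  count (fun u => (w <= u)%MM) (mons d) = 'C((d + 3) - mdeg w, 3).
Proof.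
have [le_wd|lt_dw] := leqP (mdeg w) d; last first.
  rewrite bin_small; last by lia.
  apply/eqP; rewrite -leqn0 leqNgt -has_count; apply/hasPn => u.
  rewrite mem_mons => /eqP du; apply/negP => /mnm_lepP le_wu.
  have : (mdeg w <= mdeg u)%N by rewrite !mdegE; apply: leq_sum => i _.
  by lia.
rewrite -size_filter.
have -> : ((d + 3) - mdeg w = (d - mdeg w) + 3)%N by lia.
rewrite -size_mons -[RHS](size_map (fun u => (u + w)%MM)); apply: perm_size.
apply: uniq_perm; first by rewrite filter_uniq ?uniq_mons.
  rewrite map_inj_uniq ?uniq_mons // => u v /mnmP E; apply/mnmP => i.
  by have := E i; rewrite !mnmDE => /addIn.
move=> u; rewrite mem_filter mem_mons; apply/idP/mapP => [/andP[le_wu /eqP du]|[v]].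
  exists (u - w)%MM; last by rewrite submK.
  by rewrite mem_mons -du -[X in (mdeg X - _)%N](submK le_wu) mdegD addnK.
rewrite mem_mons => /eqP dv ->; rewrite lem_addl mdegD dv; lia.
Qed.

(** A monomial [u] of degree [d] has multiplicity [d - u i] at the [i]-th vertex; those counted fall
    short of [m], and they are the multiples of the power [d + 1 - m] of the [i]-th variable. *)
Lemma count_bad d m i : (m <= d.+1)%N ->
  count (fun u : 'X_{1..4} => (d < m + u i)%N) (mons d) = 'C(m + 2, 3).
Proof.
move=> md; have -> : (m + 2 = (d + 3) - mdeg (U_(i) *+ (d.+1 - m))%MM)%N.
  by rewrite mdegMn mdeg1; lia.
rewrite -count_shift; apply: eq_count => u; apply/idP/mnm_lepP => [h j|/(_ i)].
  by rewrite mulmnE mnm1E; case: eqP => [<-|_]; lia.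
by rewrite mulmnE mnm1E eqxx; lia.
Qed.

Lemma count_bad2 d m m' i j : i != j -> (m <= d.+1)%N -> (m' <= d.+1)%N ->
  count (fun u : 'X_{1..4} => (d < m + u i)%N && (d < m' + u j)%N) (mons d) =
  'C((m + m' - d).+1, 3).
Proof.
move=> ij md m'd; pose w := (U_(i) *+ (d.+1 - m) + U_(j) *+ (d.+1 - m'))%MM.
have -> : 'C((m + m' - d).+1, 3) = 'C((d + 3) - mdeg w, 3).
  rewrite /w mdegD !mdegMn !mdeg1; have [le|lt] := leqP d (m + m').
    by congr 'C(_, _); lia.
  by rewrite !bin_small //; lia.
rewrite -count_shift; apply: eq_count => u.
have wE k : w k = ((i == k) * (d.+1 - m) + (j == k) * (d.+1 - m'))%N.
  by rewrite /w mnmDE !mulmnE !mnm1E.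
apply/idP/mnm_lepP => [/andP[h h'] k|H].
  rewrite wE; have [<-|_] := eqVneq i k; last first.
    by case: eqP => [<-|_]; lia.
  by rewrite eq_sym (negPf ij); lia.
have := H i; have := H j; rewrite !wE !eqxx (negPf ij) [j == i]eq_sym (negPf ij); lia.
Qed.

Section Sigma.
Variable K : fieldType.
Implicit Types (A B : 'M[K]_4) (f g : {mpoly K[4]}).

(** Pullback along the linear map taking the [j]-th vertex to row [j] of [A]. *)
Definition sigma A f : {mpoly K[4]} :=
  mmap (@mpolyC 4 K) (fun i => \sum_j A j i *: 'X_j) f.
HB.instance Definition _ A := GRing.RMorphism.copy (sigma A)
  (mmap (@mpolyC 4 K) (fun i => \sum_j A j i *: 'X_j)).

Lemma sigmaX A i : sigma A 'X_i = \sum_j A j i *: 'X_j.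
Proof. by rewrite /sigma mmapX mmap1U. Qed.

Lemma sigmaZD A c f g : sigma A (c *: f + g) = c *: sigma A f + sigma A g.
Proof. by rewrite rmorphD /= /sigma mmapZ mul_mpolyC. Qed.

Lemma sigmaZ A c f : sigma A (c *: f) = c *: sigma A f.
Proof. by rewrite /sigma mmapZ mul_mpolyC. Qed.

Lemma sigma_sum A (I : Type) (s : seq I) (P : pred I) (F : I -> {mpoly K[4]}) :
  sigma A (\sum_(i <- s | P i) F i) = \sum_(i <- s | P i) sigma A (F i).
Proof. exact: rmorph_sum. Qed.

Lemma sigmaM A B f : sigma A (sigma B f) = sigma (A *m B) f.
Proof.
rewrite {2}/sigma (@mmap_comp _ _ _ _ (@mpolyC 4 K) (sigma A) (@mpolyC 4 K)).
  apply: mmap_ext => i; rewrite -[LHS]/(sigma A _) sigma_sum.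
  under eq_bigr => j _ do rewrite sigmaZ sigmaX scaler_sumr.
  rewrite exchange_big; apply: eq_bigr => k _ /=; rewrite mxE scaler_suml.
  by apply: eq_bigr => j _; rewrite scalerA mulrC.
by move=> c; rewrite /= /sigma mmapC.
Qed.

Lemma sigma1 f : sigma 1%:M f = f.
Proof.
rewrite -[RHS]mpoly_id; apply: mmap_ext => i.
rewrite (bigD1 i) //= big1 ?addr0 => [|j /negPf ne]; rewrite mxE ?eqxx ?scale1r //.
by rewrite ne scale0r.
Qed.

Lemma mmap1_homog (w : 'I_4 -> {mpoly K[4]}) (u : 'X_{1..4}) :
  (forall i, w i \is 1.-homog) -> mmap1 w u \is (mdeg u).-homog.
Proof.
move=> hw; rewrite /mmap1 big_ord4 mdeg4.
have H i : w i ^+ u i \is (u i).-homog.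
  by have := dhomogMn (u i) (hw i); rewrite mul1n.
by do !apply: dhomogM.
Qed.

Lemma sigma_homog A d f : f \is d.-homog -> sigma A f \is d.-homog.
Proof.
move=> /dhomogP hf; rewrite /sigma /mmap big_seq; apply: rpred_sum => u su.
rewrite mul_mpolyC rpredZ //; have <- : mdeg u = d := hf _ su.
apply: mmap1_homog => i; apply: rpred_sum => j _.
by rewrite rpredZ // dhomogX; apply/eqP; apply: mdeg1.
Qed.

(** On a generic line leaving the [j]-th vertex, [X_j] becomes 1 and the other variables are scaled
    by the parameter. The coefficient of order [d - u j] gathers the monomials whose [j]-th exponent
    is [u j]; in fixed degree these remain distinct after deleting [X_j]. *)
Lemma vanish_to_support A j m d f :
  f \is d.-homog -> vanish_to m (fun i => A j i) f ->
  forall u : 'X_{1..4}, (d < m + u j)%N -> (sigma A f)@_u = 0.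
Proof.
move=> hf vf u du; have [u_d|/(dhomog_nemf_coeff (sigma_homog A hf)) //] := eqVneq (mdeg u) d.
pose io : {rmorphism K -> {poly {mpoly K[4]}}} :=
  GRing.RMorphism.clone _ _ (polyC \o @mpolyC 4 K) _.
pose t (k : 'I_4) : {poly {mpoly K[4]}} := if k == j then 1 else 'X * ('X_k)%:P.
pose w (i : 'I_4) : {poly {mpoly K[4]}} := \sum_(k | k != j) io (A k i) * ('X_k)%:P.
have E : mmap io (fun i => io (A j i) + 'X * w i) f = mmap io t (sigma A f).
  rewrite /sigma (@mmap_comp _ _ _ _ _ (mmap io t) io); last first.
    by move=> c; rewrite /= mmapC.
  apply: mmap_ext => i /=; rewrite raddf_sum (bigD1 j) //=.
  rewrite mmapZ mmapX mmap1U /t eqxx mulr1; congr (_ + _).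
  rewrite /w mulr_sumr; apply: eq_bigr => k /negPf kj.
  by rewrite mmapZ mmapX mmap1U kj mulrCA.
pose del (z : 'X_{1..4}) : 'X_{1..4} := [multinom (if k == j then 0%N else z k) | k < 4].
have t1 (z : 'X_{1..4}) : mdeg z = d -> mmap1 t z = 'X^(d - z j) * ('X_[del z])%:P.
  move=> dz; have -> : (d - z j = \sum_(k | k != j) z k)%N.
    by rewrite -dz mdegE (bigD1 j) //= addKn.
  rewrite /mmap1 (bigD1 j) //= /t eqxx expr1n mul1r.
  under eq_bigr => k /negPf kj do rewrite kj exprMn -rmorphXn.
  rewrite big_split /= prodrXr -rmorph_prod /=; congr (_ * _%:P).
  rewrite mpolyXE_id [RHS](bigD1 j) //= mnmE eqxx expr0 mul1r.
  by apply: eq_bigr => k /negPf kj; rewrite mnmE kj.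
have le (z : 'X_{1..4}) : (z j <= mdeg z)%N by rewrite mdegE (bigD1 j) //= leq_addr.
have lt_m : (d - u j < m)%N by have := le u; rewrite u_d; lia.
have /(congr1 (mcoeff (del u))) :=
  @vanish_to_arc _ _ _ io (fun i => A j i) w m f vf (d - u j)%N lt_m.
rewrite E mcoeff0 /mmap coef_sum raddf_sum /= big_seq.
have sh z : z \in msupp (sigma A f) -> mdeg z = d.
  by apply/dhomogP/sigma_homog.
under eq_bigr => z sz.
  rewrite t1 ?sh // coefCM coefXnM.
  have -> : ((if (d - u j < d - z j)%N then 0 else ('X_[del z])%:P`_(d - u j - (d - z j))%N) : {mpoly K[4]}) =
     if (z j == u j)%N then 'X_[del z] else 0.
    have := le z; have := le u; rewrite (sh _ sz) u_d => l1 l2.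
    case: ltnP => h; first by case: eqP => // E'; lia.
    rewrite coefC; have -> // : (d - u j - (d - z j) == 0)%N = (z j == u j)%N.
    by apply/eqP/eqP; lia.
  rewrite (fun_if (fun x => (_ * x)@__)) mulr0 mcoeff0 mcoeffCM mcoeffX.
  have -> : (if z j == u j then (sigma A f)@_z * (del z == del u)%:R else 0) =
     (sigma A f)@_z * (z == u)%:R.
    have [->|zu] := eqVneq z u; first by rewrite !eqxx.
    case: (z j =P u j) => [zj|_]; last by rewrite mulr0.
    case: (del z =P del u) => [/mnmP D|] //.
    case/eqP: zu; apply/mnmP => k; have := D k; rewrite !mnmE.
    by case: eqP => [->|].
  over.
rewrite -big_seq => <-; have [su|nu] := boolP (u \in msupp (sigma A f)).
  rewrite (bigD1_seq u) ?msupp_uniq //= eqxx mulr1 big1 ?addr0 // => z /negPf ->.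
  by rewrite mulr0.
rewrite memN_msupp_eq0 // big_seq big1 // => z sz.
by case: eqP => [E'|]; rewrite ?mulr0 //; move: nu; rewrite -E' sz.
Qed.
End Sigma.

(** * Powers of the ideal of a point *)

Section IdealPow.
Variables (R : comNzRingType) (I : R -> Prop).

Lemma ideal_pow_exp0 f : ideal_pow I 0 f.
Proof.
exists 1, (fun=> f), (fun _ _ => 0); split; first by move=> k [].
by rewrite big_ord1 big_ord0 mulr1.
Qed.

Lemma ideal_powS m g f : I g -> ideal_pow I m f -> ideal_pow I m.+1 (g * f).
Proof.
move=> Ig [n [h [t [It ->]]]].
exists n, h, (fun k j => if unlift ord0 j is Some j' then t k j' else g); split.
  by move=> k j; case: (unlift ord0 j).
rewrite mulr_sumr; apply: eq_bigr => k _; rewrite big_ord_recl unlift_none mulrCA.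
by congr (_ * (_ * _)); apply: eq_bigr => j _; rewrite liftK.
Qed.

Lemma ideal_pow_prev m f : ideal_pow I m.+1 f -> ideal_pow I m f.
Proof.
move=> [n [h [t [It ->]]]].
exists n, (fun k => h k * t k ord0), (fun k j => t k (lift ord0 j)); split=> //.
by apply: eq_bigr => k _; rewrite big_ord_recl mulrA.
Qed.

Lemma ideal_pow_le m m' f : (m <= m')%N -> ideal_pow I m' f -> ideal_pow I m f.
Proof.
move=> /subnKC <-; elim: (m' - m)%N => [|k IH]; first by rewrite addn0.
by rewrite addnS => /ideal_pow_prev.
Qed.

Lemma ideal_pow_prod (J : finType) (P : pred J) (l : J -> R) (e : J -> nat) :
  (forall i, P i -> I (l i)) ->
  ideal_pow I (\sum_(i | P i) e i)%N (\prod_(i | P i) l i ^+ e i).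
Proof.
move=> Il; elim/big_rec2: _ => [|i m f Pi Hf]; first exact: ideal_pow_exp0.
elim: (e i) => [|k IH]; first by rewrite expr0 mul1r.
by rewrite exprS -mulrA addSn; apply: ideal_powS (Il i Pi) IH.
Qed.

Lemma ideal_pow_sum (J : eqType) (s : seq J) (F : J -> R) m :
  {in s, forall i, ideal_pow I m (F i)} -> ideal_pow I m (\sum_(i <- s) F i).
Proof.
move=> H; rewrite big_seq; elim/big_rec: _ => [|i x si Hx]; first exact: ideal_pow0.
by apply: ideal_powD Hx; apply: H.
Qed.
End IdealPow.

Section Points.
Variable K : fieldType.
Implicit Types (A : 'M[K]_4) (f : {mpoly K[4]}) (p : P3 K).

Lemma coef_prod_low (D : comNzRingType) m (P : 'I_m -> {poly D}) :
  (forall j, (P j)`_0 = 0) -> forall k, (k < m)%N -> (\prod_(j < m) P j)`_k = 0.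
Proof.
elim: m P => [|m IH] P P0 k //= km; rewrite big_ord_recl coefM.
rewrite big1 // => -[[|i] /= ik] _; first by rewrite P0 mul0r.
by rewrite IH ?mulr0 //; lia.
Qed.

Lemma generic_arc0 n (v : 'I_n -> K) (f : {mpoly K[n]}) :
  (generic_arc v f)`_0 = (f.@[v])%:MP.
Proof.
rewrite -horner_coef0 -[_.[0]]/(horner_eval 0 (generic_arc v f)).
rewrite /generic_arc (@mmap_comp _ _ _ _ _ (horner_eval 0) (@mpolyC n K)); last first.
  by move=> c; rewrite /= /horner_eval hornerC.
have -> : (f.@[v])%:MP = mmap (@mpolyC n K) (@mpolyC n K \o v) f.
  exact: (@mmap_comp n K K _ idfun (@mpolyC n K) (@mpolyC n K) v f (fun=> erefl)).
apply: mmap_ext => j; rewrite /= /horner_eval hornerD hornerM hornerX mul0r addr0.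
by rewrite hornerC.
Qed.

Lemma fat_vanish m p f :
  ideal_pow (point_ideal p) m f -> vanish_to m (fun j => val p 0 j) f.
Proof.
move=> [n [h [g [Ig ->]]]]; apply/generic_arc_vanish => k km.
rewrite rmorph_sum coef_sum big1 // => i _.
rewrite rmorphM rmorph_prod coefM big1 // => -[j /= jk] _.
rewrite coef_prod_low ?mulr0 //; last by lia.
move=> t; rewrite generic_arc0; have := Ig i t 1.
rewrite (@meval_eq _ _ _ (fun j => val p 0 j)) => [->|l]; first exact: mpolyC0.
by rewrite mul1r.
Qed.

(** The forms [l i] are dual to the rows of [A], so those with [i != j] vanish at [p]. Written in
    the [l i], every monomial of [f] has [u j <= d - m], hence at least [m] such factors. *)
Lemma support_fat A p j m d f :
  A \in unitmx -> (forall i, val p 0 i = A j i) -> f \is d.-homog ->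
  (forall u : 'X_{1..4}, mdeg u = d -> (d < m + u j)%N -> (sigma A f)@_u = 0) ->
  ideal_pow (point_ideal p) m f.
Proof.
move=> uA pA hf H; pose l i : {mpoly K[4]} := \sum_k (invmx A) k i *: 'X_k.
have ->: f = \sum_(u <- msupp (sigma A f)) (sigma A f)@_u *: \prod_i l i ^+ u i.
  rewrite -[LHS]sigma1 -(mulVmx uA) -sigmaM; apply: eq_bigr => u _.
  by rewrite mul_mpolyC.
apply: ideal_pow_sum => u su; rewrite -mul_mpolyC; apply: ideal_powM.
have du : mdeg u = d by move: su; apply/dhomogP/sigma_homog.
have mu : (m + u j <= d)%N.
  by rewrite leqNgt; apply: contraL su => lt; rewrite -mcoeff_eq0 H.
rewrite (bigD1 j) //=; apply: ideal_powM.
apply: (@ideal_pow_le _ _ _ (\sum_(i | i != j) u i)).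
  by move: mu; rewrite -du mdegE (bigD1 j) //= addnC leq_add2l.
apply: ideal_pow_prod => i ij c.
rewrite /l raddf_sum /= (eq_bigr (fun k => c * (A j k * invmx A k i))) => [|k _].
  rewrite -mulr_sumr; have := mulmxV uA => /matrixP/(_ j i); rewrite !mxE => ->.
  by rewrite eq_sym (negPf ij) mulr0.
by rewrite mevalZ mevalXU pA; ring.
Qed.

Lemma support_dim_le A d (P : pred 'X_{1..4}) (Q : {mpoly K[4]} -> Prop) :
  A \in unitmx -> subspace idfun Q ->
  (forall f, Q f -> f \is d.-homog) ->
  (forall f u, Q f -> ~~ P u -> (sigma A f)@_u = 0) ->
  dim_le idfun Q (count P (mons d)).
Proof.
move=> uA sQ hQ H; rewrite -size_filter.
apply: (@dim_le_coord _ _ _ _ _ _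
  (fun (j : 'I_(size (filter P (mons d)))) f => (sigma A f)@_(nth 0%MM (filter P (mons d)) j))) => //.
  by move=> j c f g; rewrite sigmaZD mcoeffD mcoeffZ.
move=> f Qf Hf; rewrite -[f]sigma1 -(mulVmx uA) -sigmaM.
suff -> : sigma A f = 0 by rewrite rmorph0.
apply/mpolyP => u; rewrite mcoeff0.
have [du|/(dhomog_nemf_coeff (sigma_homog A (hQ _ Qf))) //] := eqVneq (mdeg u) d.
have [Pu|/(H _ _ Qf) //] := boolP (P u).
have uin : u \in filter P (mons d) by rewrite mem_filter Pu mem_mons du eqxx.
have lt : (index u (filter P (mons d)) < size (filter P (mons d)))%N by rewrite index_mem.
by have := Hf (Ordinal lt); rewrite /= nth_index.
Qed.
End Points.

(** * The upper bound *)

Lemma bin2_square n : ('C(n.+1, 2) + 'C(n, 2) = n * n)%N.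
Proof.
elim: n => // n IH; have h : 'C(n.+2, 2) = ('C(n.+1, 2) + n.+1)%N by rewrite binS bin1.
have h' : 'C(n.+1, 2) = ('C(n, 2) + n)%N by rewrite binS bin1.
by rewrite h; nia.
Qed.

(** * Monomials violating a multiplicity at a vertex *)

Section Counting.
Variables (d : nat) (m : nat -> nat).
Hypothesis mono : forall i j, (i <= j)%N -> (m j <= m i)%N.
Hypothesis m0_le : (m 0 <= d.+1)%N.
Hypothesis std : (m 0 + m 1 + m 2 + m 3 <= 2 * d)%N.

Definition bad (i : 'I_4) (u : 'X_{1..4}) := (d < m i + u i)%N.
Definition bad4 u := [|| bad o0 u, bad o1 u, bad o2 u | bad o3 u].

(* Inclusion-exclusion: in standard form no monomial is bad at three points, and
   the pairs [p_2 p_4] and [p_3 p_4] do not contribute. *)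
Lemma count_bad4 :
  (count bad4 (mons d) + ('C((m 0 + m 1 - d).+1, 3) + 'C((m 0 + m 2 - d).+1, 3) +
     'C((m 0 + m 3 - d).+1, 3) + 'C((m 1 + m 2 - d).+1, 3)) =
   'C(m 0 + 2, 3) + 'C(m 1 + 2, 3) + 'C(m 2 + 2, 3) + 'C(m 3 + 2, 3))%N.
Proof.
have := (mono (leqnSn 0), mono (leqnSn 1), mono (leqnSn 2)) => -[[m10 m21] m32].
have [m1_le m2_le m3_le] : [/\ m 1%N <= d.+1, m 2%N <= d.+1 & m 3%N <= d.+1]%N by split; lia.
set s := mons d.
have E (a b : pred 'X_{1..4}) : (count (fun u => a u || b u) s +
    count (fun u => a u && b u) s = count a s + count b s)%N by apply: count_predUI.
have sub u : u \in s -> (u o0 + (u o1 + (u o2 + u o3)) = d)%N.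
  by rewrite mem_mons mdeg4 => /eqP.
have e01 := E (bad o0) (bad o1).
have := E (fun u => bad o0 u || bad o1 u) (bad o2) => /= e2.
have := E (fun u => [|| bad o0 u, bad o1 u | bad o2 u]) (bad o3) => /= e3.
have := E (fun u => bad o0 u && bad o2 u) (fun u => bad o1 u && bad o2 u) => /= e2'.
(* Three bad points would give [m 0 + m 1 + m 2 >= 2d + 3], against [std]. In [x3], the pair
   [p_2 p_4] or [p_3 p_4] would have multiplicities of sum at least [d + 2]; by monotonicity so
   would the complementary pair, again too much. *)
have z : count (fun u => (bad o0 u && bad o2 u) && (bad o1 u && bad o2 u)) s = 0%N.
  rewrite (@eq_in_count _ _ pred0) ?count_pred0 // => u /sub su.
  by rewrite /bad /=; lia.
have x2 : count (fun u => (bad o0 u || bad o1 u) && bad o2 u) s =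
    count (fun u => bad o0 u && bad o2 u || bad o1 u && bad o2 u) s.
  by apply: eq_count => u; rewrite andb_orl.
have x2' : count (fun u => (bad o0 u || bad o1 u) || bad o2 u) s =
    count (fun u => [|| bad o0 u, bad o1 u | bad o2 u]) s.
  by apply: eq_count => u; rewrite orbA.
have x3 : count (fun u => [|| bad o0 u, bad o1 u | bad o2 u] && bad o3 u) s =
    count (fun u => bad o0 u && bad o3 u) s.
  by apply: eq_in_count => u /sub su; rewrite /bad /=; lia.
have -> : count bad4 s = count (fun u => [|| bad o0 u, bad o1 u | bad o2 u] || bad o3 u) s.
  by apply: eq_count => u; rewrite /bad4 !orbA.
rewrite -(count_bad o0 m0_le) -(count_bad o1 m1_le) -(count_bad o2 m2_le) -(count_bad o3 m3_le).
rewrite -(@count_bad2 d _ _ o0 o1 isT m0_le m1_le) -(@count_bad2 d _ _ o0 o2 isT m0_le m2_le).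
rewrite -(@count_bad2 d _ _ o0 o3 isT m0_le m3_le) -(@count_bad2 d _ _ o1 o2 isT m1_le m2_le).
rewrite -/s -/(bad o0) -/(bad o1) -/(bad o2) -/(bad o3).
by move: z e01 e2 e3 e2' x2 x2' x3; rewrite /bad /=; lia.
Qed.

Lemma count_good4 :
  (count (predC bad4) (mons d) +
     ('C(m 0 + 2, 3) + 'C(m 1 + 2, 3) + 'C(m 2 + 2, 3) + 'C(m 3 + 2, 3)) =
   'C(d + 3, 3) + ('C((m 0 + m 1 - d).+1, 3) + 'C((m 0 + m 2 - d).+1, 3) +
     'C((m 0 + m 3 - d).+1, 3) + 'C((m 1 + m 2 - d).+1, 3)))%N.
Proof.
by have := count_bad4; have := count_predC bad4 (mons d); rewrite size_mons; lia.
Qed.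
End Counting.

(** * Surfaces through the special configuration *)

Section Special.
Variable K : fieldType.
Hypothesis char0 : [pchar K] =i pred0.

Lemma natr_inj_char0 (a b : nat) : (a%:R == b%:R :> K) = (a == b).
Proof.
have nz n : (n%:R == 0 :> K) = (n == 0%N) by move/pcharf0P: char0.
wlog le_ab : a b / (a <= b)%N => [H|].
  by case/orP: (leq_total a b) => /H //; rewrite eq_sym => ->; rewrite eq_sym.
by rewrite eq_sym -subr_eq0 -natrB // nz subn_eq0 eqn_leq le_ab.
Qed.

(* Eight points of the quadric, alternately on its tangent conic sections
   [y = x] and [y = x + 1]. *)
Definition abscissa (i : nat) : K := i.*2%:R.
Definition ordinate (i : nat) : K := (i.*2 + odd i)%:R.
Local Notation point i := (quad_vec (abscissa i) (ordinate i)).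

Definition surfaces d (m : nat -> nat) (f : {mpoly K[4]}) : Prop :=
  f \is d.-homog /\ forall i, (i < 8)%N -> vanish_to (m i) (point i) f.

Lemma surfaces_subspace d m : subspace idfun (surfaces d m).
Proof.
split=> [|c f g [hf vf] [hg vg]]; first split; first exact: rpred0.
  by move=> i _; apply: (proj1 (vanish_to_subspace _ _)).
split=> [|i i8]; first by rewrite rpredD // rpredZ.
by apply: (proj2 (vanish_to_subspace _ _)); [apply: vf | apply: vg].
Qed.

Lemma surfaces_quadric d (m : nat -> nat) :
  (forall i j, (i <= j)%N -> (m j <= m i)%N) -> (m 0 <= d.+1)%N ->
  (m 0 + m 1 + m 2 + m 3 <= 2 * d)%N ->
  exists N, (N + \sum_(i < 8) 'C((m i).+1, 2) = d.+1 * d.+1)%N /\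
    dim_le (@polyC K) (biforms (fun i : 'I_8 => abscissa i) (fun i => ordinate i)
      d.+1 d.+1 (fun i => m i)) N.
Proof.
have E0 (i : 'I_8) : (ordinate i == abscissa i + 0) = ~~ odd i.
  by rewrite addr0 natr_inj_char0; case: (odd i); rewrite ?addn0 ?eqxx //; lia.
have E1 (i : 'I_8) : (ordinate i == abscissa i + 1) = odd i.
  rewrite /ordinate /abscissa -[1]/(1%:R) -natrD natr_inj_char0.
  by case: (odd i); rewrite ?eqxx //; lia.
apply: quadric_bound => //.
- by move=> i j /eqP; rewrite natr_inj_char0 => /eqP /double_inj /val_inj.
(* Spacing the abscissas by 2 keeps the ordinates distinct in spite of the shift by one at odd
   indices. *)
- move=> i j /eqP; rewrite natr_inj_char0 => /eqP E; apply: val_inj => /=.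
  by move: E; case: (odd i); case: (odd j) => /=; lia.
(* The abscissas sum to 24 at even and to 32 at odd indices, and [24 - 32] differs from 2 in
   characteristic 0. *)
rewrite (eq_bigl _ _ E0) (eq_bigl _ _ E1) -!natr_sum.
rewrite (sum_ord8 double (fun i => ~~ odd i)) (sum_ord8 double odd) /=.
rewrite !big_cons !big_nil /= subr_eq -natrD natr_inj_char0.
by [].
Qed.

Definition frame : 'M[K]_4 := \matrix_(i, j) point i j.

Lemma unitmx_scalar (A B : 'M[K]_4) (c : K) :
  c != 0 -> A *m B = c%:M -> A \in unitmx.
Proof.
move=> c0 AB; apply: (proj1 (@mulmx1_unit _ _ A (c^-1 *: B) _)).
by rewrite -scalemxAr AB scale_scalar_mx mulVf.
Qed.

Lemma frame_unit : frame \in unitmx.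
Proof.
(* [frame] has determinant -80, and [B] is the opposite of its adjugate. *)
pose B : 'M[K]_4 := \matrix_(i, j) nth 0 (nth [::]
  [:: [:: 80%:R; 0; 0; 0]; [:: -4%:R; -56%:R; 84%:R; -24%:R];
      [:: -32%:R; 72%:R; -48%:R; 8%:R]; [:: 4%:R; -4%:R; -4%:R; 4%:R]] i) j.
apply: (@unitmx_scalar _ B 80%:R); first by move/pcharf0P: char0 => ->.
apply/matrixP; apply: ord4P; apply: ord4P;
  rewrite !mxE big_ord4 !mxE /quad_vec /abscissa /ordinate -!addnn /=; ring.
Qed.

(* Points are numbered from 0: the first term is the line [p_2 p_3] of the
   statement, the others are the lines [p_1 p_i]. *)
Definition line_excess d (m : nat -> nat) : nat :=
  ('C((m 1 + m 2 - d).+1, 3) + \sum_(1 <= i < 8) 'C((m 0 + m i - d).+1, 3))%N.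

Lemma surfaces_bound d (m : nat -> nat) :
  (forall i j, (i <= j)%N -> (m j <= m i)%N) -> (m 0 <= d.+1)%N ->
  (m 0 + m 1 + m 2 + m 3 <= 2 * d)%N ->
  exists N, (N + \sum_(i < 8) 'C(m i + 2, 3) = 'C(d + 3, 3) + line_excess d m)%N /\
    dim_le idfun (surfaces d m) N.
Proof.
elim/ltn_ind: d m => d IH m mono m0 std.
have m_ i := mono i i.+1 (leqnSn i).
have := (m_ 0, m_ 1, m_ 2, m_ 3)%N => -[[[m10 m21] m32] m43].
have := (m_ 4, m_ 5, m_ 6)%N => -[[m54 m65] m76].
have low i : (m 0 + i - d <= 1)%N -> 'C((m 0 + i - d).+1, 3) = 0%N.
  by move=> h; rewrite bin_small //; lia.
have TE : line_excess d m = ('C((m 1 + m 2 - d).+1, 3) + ('C((m 0 + m 1 - d).+1, 3) +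
  ('C((m 0 + m 2 - d).+1, 3) + ('C((m 0 + m 3 - d).+1, 3) + ('C((m 0 + m 4 - d).+1, 3) +
  ('C((m 0 + m 5 - d).+1, 3) + ('C((m 0 + m 6 - d).+1, 3) +
   'C((m 0 + m 7 - d).+1, 3))))))))%N.
  by rewrite /line_excess /index_iota /= !big_cons big_nil addn0.
have sE : (\sum_(i < 8) 'C(m i + 2, 3) = 'C(m 0 + 2, 3) + ('C(m 1 + 2, 3) +
  ('C(m 2 + 2, 3) + ('C(m 3 + 2, 3) + ('C(m 4 + 2, 3) + ('C(m 5 + 2, 3) +
  ('C(m 6 + 2, 3) + 'C(m 7 + 2, 3))))))))%N.
  by rewrite (sum_ord8 (fun i => 'C(m i + 2, 3)) xpredT) /= !big_cons big_nil addn0.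
have [m3|m3] := posnP (m 3%N).
  exists (count (predC (bad4 d m)) (mons d)); split.
    have := count_good4 mono m0 std; rewrite sE TE.
    have -> : m 7%N = 0%N by lia.
    have -> : m 6%N = 0%N by lia.
    have -> : m 5%N = 0%N by lia.
    have -> : m 4%N = 0%N by lia.
    have z0 : 'C((m 0 + 0 - d).+1, 3) = 0%N by apply: low; lia.
    have z1 : 'C(0 + 2, 3) = 0%N by [].
    by rewrite m3 !z0 !z1; lia.
  apply: (support_dim_le frame_unit (surfaces_subspace d m)) => [f []//|f u [hf vf]].
  have H (i : 'I_4) : bad d m i u -> (sigma frame f)@_u = 0.
    have i8 : (i < 8)%N by apply: leq_trans (ltn_ord i) _.
    have vi : vanish_to (m i) (fun k => frame i k) f.
      move=> b bm; rewrite -(vf i i8 b bm) /hasse; apply: eq_bigr => z _.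
      by congr (_ * _); apply: eq_bigr => j _; rewrite mxE.
    exact: vanish_to_support hf vi _.
  by rewrite /= negbK /bad4 => /or4P[] /H.
(* No nonzero form of degree [d] has a point of multiplicity [d + 1]. The formula agrees: each line
   [p_1 p_i] gives back the [C(m_i + 2, 3)] conditions of [p_i], and those of [p_1] exhaust
   [C(d + 3, 3)]. *)
have [m0d|m0d] := eqVneq (m 0%N) d.+1.
  exists 0%N; split.
    have t i : 'C((m 0 + i - d).+1, 3) = 'C(i + 2, 3).
      by rewrite m0d; congr 'C(_, _); lia.
    have z : 'C((m 1%N + m 2%N - d).+1, 3) = 0%N by rewrite bin_small //; lia.
    have y : 'C(m 0%N + 2, 3) = 'C(d + 3, 3) by rewrite m0d; congr 'C(_, _); lia.
    by rewrite sE TE !t z y; lia.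
  apply: dim_le0 => f [hf vf]; apply/mpolyP => u; rewrite mcoeff0.
  have [du|/(dhomog_nemf_coeff hf) //] := eqVneq (mdeg u) d.
  rewrite -[f]sigma1 -(mulVmx frame_unit) -sigmaM.
  suff -> : sigma frame f = 0 by rewrite rmorph0 mcoeff0.
  apply/mpolyP => z; rewrite mcoeff0.
  have vi : vanish_to (m 0%N) (fun k => frame o0 k) f.
    move=> b bm; rewrite -(vf 0%N isT b bm) /hasse; apply: eq_bigr => y _.
    by congr (_ * _); apply: eq_bigr => j _; rewrite mxE.
  by apply: (vanish_to_support hf vi); rewrite m0d; lia.
case: d => [|[|d]] in IH m0 std low TE m0d *; [lia | lia |].
have [||||N [EN HN]] := IH d _ (fun i => (m i).-1); try lia.
  by move=> i j /mono; lia.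
have [N2 [EN2 HN2]] := surfaces_quadric mono m0 std.
exists (N2 + N)%N; split.
  have T_eq : line_excess d (fun i => (m i).-1) = line_excess d.+2 m.
    (* A zero multiplicity does not drop, but both binomials then vanish, since the other
       multiplicity is at most [d + 2]. *)
    have t i j : (m i <= d.+2)%N -> (m j <= d.+2)%N ->
        'C(((m i).-1 + (m j).-1 - d).+1, 3) = 'C((m i + m j - d.+2).+1, 3).
      move=> mi mj; case: (posnP (m i)) => [->|pi]; first by rewrite !bin_small //; lia.
      case: (posnP (m j)) => [->|pj]; first by rewrite !bin_small //; lia.
      by congr 'C(_, _); lia.
    have le i : (m i <= d.+2)%N by have := mono 0%N i isT; lia.
    rewrite /line_excess t //; congr (_ + _)%N; apply: eq_bigr => i _.
    by rewrite t.
  have C_eq : (\sum_(i < 8) 'C(m i + 2, 3) =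
      \sum_(i < 8) 'C((m i).-1 + 2, 3) + \sum_(i < 8) 'C((m i).+1, 2))%N.
    rewrite -big_split; apply: eq_bigr => i _ /=.
    by case: (m i) => // t; rewrite addSn binS addn2.
  have D_eq : ('C(d.+2 + 3, 3) = 'C(d + 3, 3) + d.+3 * d.+3)%N.
    have h1 : ('C(d.+2 + 3, 3) = 'C(d.+4, 3) + 'C(d.+4, 2))%N by rewrite addn3 binS.
    have h2 : ('C(d.+4, 3) = 'C(d.+3, 3) + 'C(d.+3, 2))%N by rewrite binS.
    have h3 : ('C(d.+4, 2) + 'C(d.+3, 2) = d.+3 * d.+3)%N.
      exact: bin2_square.
    by rewrite h1 h2 addn3; lia.
  by rewrite T_eq in EN; rewrite C_eq D_eq; lia.
apply: (@dim_le_step _ _ _ _ _ _ (@polyC K) _ _ idfun _ _ (surfaces d (fun i => (m i).-1)) _ _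
   (@theta K) (fun g => quadric K * g)) HN2 HN.
- exact: surfaces_subspace.
- by move=> c f g; rewrite thetaZD.
- by move=> c f g; rewrite mulrDr -scalerAr.
- move=> f [hf vf]; have [kf nf] := size_theta hf; split=> // i.
  by apply: theta_vanish; apply: vf; apply: ltn_ord.
move=> f [hf vf] f0; have [g hg E] := theta_kernel hf f0.
exists g => //; split; first by move: hg; rewrite subn2.
move=> i i8; have [e0 e1] := quadric_simple (abscissa i) (ordinate i).
by apply: (vanish_to_cancel e0 e1); rewrite -E; apply: vf.
Qed.
End Special.

(** * The lower bound *)

Section Minors.
Variable K : fieldType.

Lemma unit_minor p q (M : 'M[K]_(p, q)) :
  exists (f : 'I_(\rank M) -> 'I_p) (g : 'I_(\rank M) -> 'I_q),
    mxsub f g M \in unitmx.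
Proof.
pose f := maxrankfun M; pose M1 := rowsub f M.
have full : row_full M1^T by rewrite /row_full mxrank_tr; apply: maxrowsub_free.
exists f, (fullrankfun full); rewrite -unitmx_tr.
by have := fullrowsub_unit full; rewrite /M1 -trmx_mxsub -mxsub_comp.
Qed.

Lemma minor_rank p q r (f : 'I_r -> 'I_p) (g : 'I_r -> 'I_q) (M : 'M[K]_(p, q)) :
  mxsub f g M \in unitmx -> (r <= \rank M)%N.
Proof.
move=> /mxrank_unit <-; have -> : mxsub f g M = rowsub f 1%:M *m (M *m colsub g 1%:M).
  by rewrite mulmx_colsub mulmx1 -rowsubE -mxsub_comp.
exact: leq_trans (mxrankM_maxr _ _) (mxrankM_maxl _ _).
Qed.

Lemma dim_ge_conditions (V : vectType K) (W : {vspace V}) R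
    (phi : 'I_R -> V -> K) :
  (forall j c u v, phi j (c *: u + v) = c * phi j u + phi j v) ->
  (forall v, (forall j, phi j v = 0) -> v \in W) ->
  (\dim {:V} <= \dim W + R)%N.
Proof.
move=> phiL phiW; pose h v : 'rV[K]_R := \row_j phi j v.
have hL : linear h by move=> c u v; apply/rowP => j; rewrite !mxE phiL.
pose hl : {linear V -> 'rV[K]_R} := HB.pack h (GRing.isLinear.Build K V 'rV[K]_R *:%R h hL).
have := limg_ker_dim (linfun hl) fullv; rewrite capfv => <-.
apply: leq_add.
  apply: dimvS; apply/subvP => v; rewrite memv_ker lfunE /= => /eqP/rowP hv.
  by apply: phiW => j; have := hv j; rewrite !mxE.
by rewrite (leq_trans (dimvS (subvf _))) // dimvf /dim /= mul1n.
Qed.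

Lemma dim_le_rank (V : vectType K) (W : {vspace V}) c
    (M : 'M[K]_(\dim {:V}, c)) :
  (forall v, v \in W -> (\row_i coord (vbasis fullv) i v) *m M = 0) ->
  (\dim W + \rank M <= \dim {:V})%N.
Proof.
move=> H; pose X : 'M[K]_(\dim W, \dim {:V}) :=
  \matrix_(i, j) coord (vbasis fullv) j (vbasis W)`_i.
have XM : X *m M = 0.
  apply/row_matrixP => i; rewrite row_mul row0.
  have -> : row i X = \row_j coord (vbasis fullv) j (vbasis W)`_i.
    by apply/rowP => j; rewrite !mxE.
  by apply: H; apply: vbasis_mem; apply: mem_nth; rewrite size_tuple.
have fX : row_free X.
  apply: inj_row_free => u uX; apply/rowP => i; rewrite mxE.
  have /freeP F := basis_free (vbasisP W); apply: F.
  rewrite (coord_vbasis (memvf (\sum_i _))) big1 // => j _.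
  suff -> : coord (vbasis fullv) j (\sum_i u 0 i *: (vbasis W)`_i) = 0 by rewrite scale0r.
  rewrite linear_sum /=; move/rowP/(_ j): uX; rewrite !mxE => E.
  by rewrite -[RHS]E; apply: eq_bigr => k _; rewrite linearZ mxE.
by have := mulmx0_rank_max XM; rewrite (eqP fX).
Qed.
End Minors.

Section Homogeneity.
Variables (K : fieldType) (n : nat) (mf : measure n).
Implicit Types (F : {mpoly K[n]}).

Lemma prod_homog (I : finType) (P : pred I) (F : I -> {mpoly K[n]}) (e : I -> nat) :
  (forall i, P i -> F i \is (e i).-homog for mf) ->
  \prod_(i | P i) F i \is (\sum_(i | P i) e i)%N.-homog for mf.
Proof.
move=> H; elim/big_rec2: _ => [|i k g Pi Hg]; first exact: dhomog1.
by apply: dhomogM => //; apply: H.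
Qed.

Lemma det_homog r (N : 'M[{mpoly K[n]}]_r) (e : 'I_r -> nat) :
  (forall i j, N i j \is (e i).-homog for mf) ->
  \det N \is (\sum_i e i)%N.-homog for mf.
Proof.
move=> H; apply: rpred_sum => s _; rewrite rpredMsign.
exact: prod_homog.
Qed.
End Homogeneity.

Lemma dim_forms (K : fieldType) d : \dim {: dhomog 4 K d} = 'C(d + 3, 3).
Proof. by rewrite dimvf /dim /= -bin_sub ?leq_addr // addKn. Qed.

Lemma dim_ge_seq (K : fieldType) (V : vectType K) (W : {vspace V}) (T : eqType)
    (L : seq T) (phi : T -> V -> K) :
  (forall t c u v, phi t (c *: u + v) = c * phi t u + phi t v) ->
  (forall v, {in L, forall t, phi t v = 0} -> v \in W) ->
  (\dim {:V} <= \dim W + size L)%N.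
Proof.
move=> phiL phiW.
apply: (@dim_ge_conditions _ _ _ _ (fun j : 'I_(size L) => phi (tnth (in_tuple L) j))).
  by move=> j; apply: phiL.
move=> v H; apply: phiW => t tL; have /tnthP [j ->] : t \in in_tuple L by [].
exact: H.
Qed.

Section LowerBound.
Variables (K : fieldType) (a d : nat) (m : a.-tuple nat) (p : config K a).
Hypothesis a8 : (a <= 8)%N.
Local Notation mm := (fun i => nth 0%N m i).
Hypothesis mono : forall i j, (i <= j)%N -> (mm j <= mm i)%N.
Hypothesis m0_le : (mm 0 <= d.+1)%N.
Hypothesis std : (mm 0 + mm 1 + mm 2 + mm 3 <= 2 * d)%N.
Variable A : 'M[K]_4.
Hypothesis A_unit : A \in unitmx.
Hypothesis A_row : forall (i : 'I_a) (k : 'I_4), i = k :> nat ->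
  forall j, val (p i) 0 j = A k j.
Variable B : 'I_a -> 'M[K]_4.
Hypothesis B_unit : forall i : 'I_a, (4 <= i)%N -> B i \in unitmx.
Hypothesis B_row0 : forall i i0 : 'I_a, (4 <= i)%N -> i0 = 0%N :> nat ->
  forall j, val (p i0) 0 j = B i o0 j.
Hypothesis B_row1 : forall i : 'I_a, (4 <= i)%N -> forall j, val (p i) 0 j = B i o1 j.

(* In coordinates where [p_1] and [p_i] are the first two vertices: the conditions
   imposed at [p_i] on the surfaces which have the required multiplicity at [p_1]. *)
Definition far_conditions (i : nat) : pred 'X_{1..4} :=
  fun u => (d < mm i + u o1)%N && ~~ (d < mm 0 + u o0)%N.

Lemma count_far i :
  (count (far_conditions i) (mons d) + 'C((mm 0 + mm i - d).+1, 3) = 'C(mm i + 2, 3))%N.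
Proof.
have mi : (mm i <= d.+1)%N by apply: leq_trans (mono (leq0n i)) m0_le.
rewrite -(count_bad o1 mi) -(@count_bad2 d _ _ o0 o1 isT m0_le mi).
rewrite /far_conditions; set s := mons d; elim: s => //= u s IH.
by case: (d < mm i + u o1)%N; case: (d < mm 0%N + u o0)%N => /=; lia.
Qed.

(** A label names a coordinate system, [A] for [None] and [B i] for [Some i], and a monomial whose
    coefficient in that system must vanish. *)
Definition conditions : seq (option 'I_a * 'X_{1..4}) :=
  [seq (None, u) | u <- filter (bad4 d mm) (mons d)] ++
  [seq (Some i, u) | i : 'I_a <- [seq i : 'I_a <- enum 'I_a | (4 <= i)%N],
                     u : 'X_{1..4} <- filter (far_conditions i) (mons d)].

Lemma size_conditions :
  (size conditions + line_excess d mm = \sum_(i < 8) 'C(mm i + 2, 3))%N.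
Proof.
have far : (\sum_(i <- enum 'I_a | (4 <= i)%N) count (far_conditions i) (mons d) +
    \sum_(4 <= i < 8) 'C((mm 0 + mm i - d).+1, 3) = \sum_(4 <= i < 8) 'C(mm i + 2, 3))%N.
  have -> : (\sum_(i <- enum 'I_a | (4 <= i)%N) count (far_conditions i) (mons d) =
     \sum_(4 <= i < 8) count (far_conditions i) (mons d))%N.
    rewrite big_enum_cond /= (big_ord_widen_cond 8 (fun i => 4 <= i)%N
       (fun i => count (far_conditions i) (mons d)) a8).
    rewrite [RHS](@big_nat_widenl _ _ _ 4 0) // big_mkord [RHS](bigID (fun i : 'I_8 => i < a)%N) /=.
    rewrite [X in (_ + X)%N]big1 ?addn0 => [|i /andP[i4 ia]].
      by apply: eq_bigl.
    have mi0 : mm i = 0%N by rewrite nth_default // size_tuple leqNgt.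
    by have := count_far i; rewrite [X in _ = X]bin_small ?mi0 //; lia.
  by rewrite -big_split; apply: eq_bigr => i _; apply: count_far.
rewrite size_cat size_map size_filter size_allpairs_dep sumnE big_map.
rewrite (eq_bigr (fun i : 'I_a => count (far_conditions i) (mons d))) => [|i _]; last first.
  by rewrite size_filter.
rewrite big_filter /line_excess.
have := count_bad4 mono m0_le std; move: far.
rewrite (sum_ord8 (fun i => 'C(mm i + 2, 3)) xpredT) /index_iota /= !big_cons !big_nil.
by lia.
Qed.

Lemma dim_lower :
  ('C(d + 3, 3) + line_excess d mm <=
   \dim (linear_system d m p) + \sum_(i < 8) 'C(mm i + 2, 3))%N.
Proof.
rewrite -size_conditions addnA leq_add2r -(dim_forms K).
apply: (@dim_ge_seq _ _ _ _ conditions (fun t (f : dhomog 4 K d) =>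
  (sigma (if t.1 is Some i then B i else A) f)@_(t.2))).
  by move=> t c u v; rewrite linearP /= sigmaZD mcoeffD mcoeffZ.
move=> f Hf; apply/mem_linear_system.
have hf := dhomog_is_dhomog f.
have fatlow (i : 'I_a) : (i < 4)%N -> ideal_pow (point_ideal (p i)) (tnth m i) f.
  move=> i4; apply: (@support_fat _ A _ (Ordinal i4) _ d) => //.
    exact: A_row.
  move=> u du lt; apply: (Hf (None, u)); rewrite mem_cat map_f //.
  rewrite mem_filter mem_mons du eqxx andbT /bad4.
  have : bad d mm (Ordinal i4) u by move: lt; rewrite (tnth_nth 0%N).
  by case: i i4 {lt} => -[|[|[|[|i]]]] //= ia i4; rewrite (bool_irrelevance i4 isT) => ->; rewrite ?orbT.
move=> i; have [i4|i4] := ltnP i 4; first exact: fatlow.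
apply: (@support_fat _ (B i) _ o1 _ d) => //; first exact: B_unit.
  exact: B_row1.
(* If the monomial is also bad at [p_1], its coefficient vanishes because [f] already has
   multiplicity [m_1] there; this is the saving of [C(t_i + 1, 3)] conditions. *)
move=> u du lt; have [bad0|ok0] := boolP (d < mm 0%N + u o0)%N.
  have a0 : (0 < a)%N by apply: leq_ltn_trans (ltn_ord i).
  have := fatlow (Ordinal a0) isT; rewrite (tnth_nth 0%N) /= => /fat_vanish vf.
  apply: (vanish_to_support hf _ bad0) => b bm; rewrite -(vf b bm) /hasse.
  apply: eq_bigr => z _; congr (_ * _); apply: eq_bigr => j _.
  by rewrite (B_row0 i4 (i0 := Ordinal a0)).
apply: (Hf (Some i, u)); rewrite mem_cat; apply/orP; right.
apply: allpairs_f_dep; first by rewrite mem_filter i4 mem_enum.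
by rewrite mem_filter mem_mons du eqxx andbT /far_conditions ok0 andbT -(tnth_nth 0%N).
Qed.
End LowerBound.

(** * Semicontinuity *)

(** The degree in the coordinates of the [i]-th point, registered as a measure below so that
    multihomogeneity becomes homogeneity for every such weight. *)
Definition point_weight (a : nat) (i : 'I_a) (u : 'X_{1..a * 4}) : nat :=
  \sum_(j < 4) u (mxvec_index i j).

Lemma point_weight0 a (i : 'I_a) : point_weight i 0%MM = 0%N.
Proof. by rewrite /point_weight big1 // => j _; rewrite mnm0E. Qed.

Lemma point_weightD a (i : 'I_a) :
  {morph point_weight i : u v / (u + v)%MM >-> (u + v)%N}.
Proof.
by move=> u v; rewrite /point_weight -big_split; apply: eq_bigr => j _; rewrite mnmDE.
Qed.

HB.instance Definition _ a (i : 'I_a) :=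
  isMeasure.Build (a * 4) (point_weight i) (point_weight0 i) (point_weightD i).

Lemma multihomogeneousP (K : fieldType) a (F : {mpoly K[a * 4]}) (e : 'I_a -> nat) :
  (forall i, F \is (e i).-homog for (point_weight i)) -> multihomogeneous F.
Proof. by move=> H; exists e => u su i; move/dhomogP: (H i); apply. Qed.

Section Generic.
Variables (K : fieldType) (a d : nat) (m : a.-tuple nat).
Local Notation R := {mpoly K[a * 4]}.
Local Notation mm := (fun i => nth 0%N m i).
Local Notation D := (\dim {: dhomog 4 K d}).

Definition coords (p : config K a) (k : 'I_(a * 4)) : K :=
  mxvec (\matrix_(i < a, j < 4) (val (p i)) 0 j) 0 k.

Definition var (i : 'I_a) (j : 'I_4) : R := 'X_(mxvec_index i j).

Lemma var_eval p i j : (var i j).@[coords p] = val (p i) 0 j.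
Proof. by rewrite /var mevalXU /coords mxvecE mxE. Qed.

Lemma mxvec_index_eq (i i' : 'I_a) (j j' : 'I_4) :
  (mxvec_index i j == mxvec_index i' j') = (i == i') && (j == j').
Proof.
apply/eqP/andP => [|[/eqP -> /eqP ->] //].
move=> /cast_ord_inj /enum_rank_inj E.
have [-> ->] : i = i' /\ j = j' by case: E.
by rewrite !eqxx.
Qed.

Lemma var_homog i j (i0 : 'I_a) : var i j \is (i == i0 : nat).-homog for (point_weight i0).
Proof.
rewrite /var dhomogX; apply/eqP; rewrite /= /point_weight.
under eq_bigr => k _ do rewrite mnm1E mxvec_index_eq.
have [_|ne] := eqVneq i i0; last by rewrite big1.
by rewrite (bigD1 j) //= eqxx big1 // => k /negPf; rewrite eq_sym => ->.
Qed.

Lemma const_homog (c : K) (i0 : 'I_a) : (c%:MP : R) \is 0.-homog for (point_weight i0).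
Proof. by rewrite -[c%:MP]mulr1 mul_mpolyC rpredZ // dhomog1. Qed.

(* Missing points are taken from the special configuration. *)
Definition var_or_point (i : nat) (j : 'I_4) : R :=
  if insub i is Some i' then var i' j
  else (quad_vec (abscissa K i) (ordinate K i) j)%:MP.

Lemma var_or_point_homog i j (i0 : 'I_a) :
  var_or_point i j \is (i == i0 : nat).-homog for (point_weight i0).
Proof.
rewrite /var_or_point; case: insubP => [i' _ <-|ni].
  by rewrite val_eqE; apply: var_homog.
have -> : (i == i0) = false by apply: contraNF ni => /eqP ->.
exact: const_homog.
Qed.

Definition frame_poly : 'M[R]_4 := \matrix_(i, j) var_or_point i j.

(** Two fixed vertices complete the frame: constant rows have weight 0, so the determinant stays
    multihomogeneous, and at the special configuration it is nonzero because the abscissas of points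
    0 and [k] differ for [k > 0]. *)
Definition pair_poly (k : 'I_a) : 'M[R]_4 :=
  \matrix_(i, j) nth 0 [:: var_or_point 0 j; var k j; (j == o2)%:R; (j == o3)%:R] i.

Definition hasse_poly (b : 'I_4 -> nat) (k : 'I_a) (f : {mpoly K[4]}) : R :=
  \sum_(u <- msupp f) f@_u *: \prod_(j < 4) ('C(u j, b j)%:R * var k j ^+ (u j - b j)).

Lemma hasse_poly_eval b k f p :
  (hasse_poly b k f).@[coords p] = hasse b (fun j => val (p k) 0 j) f.
Proof.
rewrite /hasse_poly raddf_sum; apply: eq_bigr => u _ /=.
rewrite mevalZ rmorph_prod; congr (_ * _); apply: eq_bigr => j _ /=.
by rewrite rmorphM rmorph_nat rmorphXn /= var_eval.
Qed.

Lemma hasse_poly_homog b k f (i0 : 'I_a) : f \is d.-homog ->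
  hasse_poly b k f \is ((d - \sum_j b j) * (k == i0))%N.-homog for (point_weight i0).
Proof.
move=> /dhomogP hf; rewrite /hasse_poly big_seq; apply: rpred_sum => u su.
have du : mdeg u = d := hf _ su; rewrite mdegE in du.
apply: rpredZ; have [le_bu|] := boolP [forall j, (b j <= u j)%N]; last first.
  rewrite negb_forall => /existsP [j lt]; rewrite (bigD1 j) //= bin_small ?mul0r ?rpred0 //.
  by rewrite ltnNge.
have -> : ((d - \sum_j b j) * (k == i0) = \sum_j (k == i0) * (u j - b j))%N.
  rewrite -big_distrr /= mulnC; congr (_ * _)%N; rewrite -du sumnB // => j _.
  by move/forallP: le_bu.
apply: prod_homog => j _; rewrite -[((k == i0) * _)%N]add0n; apply: dhomogM.
  by rewrite -mpolyC_nat; apply: const_homog.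
by apply: dhomogMn; apply: var_homog.
Qed.

Local Notation T := ('I_a * {ffun 'I_4 -> 'I_d.+1})%type.

Definition basis_form (i : 'I_D) : dhomog 4 K d := (vbasis fullv)`_i.

Definition condition (t : 'I_#|{: T}|) : T := enum_val t.

(** Columns run over all orders with entries at most [d], which covers every order below [m_i] when
    [m_i <= d + 1]; the column of an order that is not imposed is zero. *)
Definition cond_poly : 'M[R]_(D, #|{: T}|) :=
  \matrix_(i, t) let kb := condition t in
    if (\sum_j kb.2 j < mm kb.1)%N
    then hasse_poly (fun j => kb.2 j) kb.1 (mpoly_of_dhomog (basis_form i)) else 0.

Lemma cond_poly_homog i t (i0 : 'I_a) :
  cond_poly i t \is ((d - \sum_j (condition t).2 j) * ((condition t).1 == i0))%N.-homog
    for (point_weight i0).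
Proof.
rewrite mxE /=; case: ifP => _; last exact: rpred0.
exact/hasse_poly_homog/dhomog_is_dhomog.
Qed.

Definition conds (p : config K a) : 'M[K]_(D, #|{: T}|) := map_mx (meval (coords p)) cond_poly.

Lemma hasse_combination b v (c : 'I_D -> K) :
  hasse b v (mpoly_of_dhomog (\sum_i c i *: basis_form i)) =
  \sum_i c i * hasse b v (mpoly_of_dhomog (basis_form i)).
Proof.
rewrite raddf_sum; have H := @semilinear_sum K K K {mpoly K[4]} K^o idfun idfun (hasse b v)
  (fun c u w => hasseZD b v c u w) D c (fun i => mpoly_of_dhomog (basis_form i)).
by rewrite -[RHS]H; congr hasse; apply: eq_bigr => i _; rewrite linearZ.
Qed.

Lemma row_conds p (c : 'rV[K]_D) t : (c *m conds p) 0 t =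
  if (\sum_j (condition t).2 j < mm (condition t).1)%N
  then hasse (fun j => (condition t).2 j) (fun j => val (p (condition t).1) 0 j)
    (mpoly_of_dhomog (\sum_i c 0 i *: basis_form i)) else 0.
Proof.
rewrite hasse_combination mxE; case: ifP => h; last first.
  by rewrite big1 // => i _; rewrite !mxE /= h rmorph0 mulr0.
by apply: eq_bigr => i _; rewrite !mxE /= h hasse_poly_eval.
Qed.

Lemma system_conds p v : v \in linear_system d m p ->
  (\row_i coord (vbasis fullv) i v) *m conds p = 0.
Proof.
move=> /mem_linear_system fat; apply/rowP => t; rewrite row_conds [RHS]mxE.
case: ifP => // h; have -> : \sum_i (\row_i coord (vbasis fullv) i v) 0 i *:
    basis_form i = v.
  by rewrite [RHS](coord_vbasis (memvf v)); apply: eq_bigr => i _; rewrite mxE.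
apply: (fat_vanish (fat (condition t).1)).
by rewrite (tnth_nth 0%N).
Qed.
End Generic.

(** * The condition matrix at the special configuration *)

Section SpecialConfig.
Variables (K : fieldType) (a : nat).
Hypothesis char0 : [pchar K] =i pred0.

Definition special_row (i : nat) : 'rV[K]_4 := \row_j quad_vec (abscissa K i) (ordinate K i) j.

Lemma special_row_neq0 i : special_row i != 0.
Proof.
apply/eqP => /rowP/(_ o0); rewrite !mxE /quad_vec /= => /eqP.
by rewrite oner_eq0.
Qed.

Definition special_config : config K a := fun i => exist _ (special_row i) (special_row_neq0 i).

Lemma special_configE (i : 'I_a) j :
  val (special_config i) 0 j = quad_vec (abscissa K i) (ordinate K i) j.
Proof. by rewrite /= mxE. Qed.

Lemma var_or_point_special (i : nat) j :
  (var_or_point K a i j).@[coords special_config] = quad_vec (abscissa K i) (ordinate K i) j.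
Proof.
rewrite /var_or_point; case: insubP => [i' _ <-|_]; last by rewrite mevalC.
by rewrite var_eval special_configE.
Qed.

Lemma frame_special : map_mx (meval (coords special_config)) (frame_poly K a) = frame K.
Proof. by apply/matrixP => i j; rewrite !mxE var_or_point_special. Qed.

Lemma pair_special (k : 'I_a) : (0 < k)%N ->
  map_mx (meval (coords special_config)) (pair_poly K k) \in unitmx.
Proof.
move=> k0; set x := abscissa K k; set y := ordinate K k.
have x0 : x != 0.
  by rewrite /x /abscissa (_ : 0 = 0%:R) // natr_inj_char0 //; lia.
have xz : abscissa K 0 = 0 by [].
have yz : ordinate K 0 = 0 by [].
(* [C] is [x] times the inverse of the matrix with rows [(1, 0, 0, 0)], [(1, x, y, x y)] and the
   last two unit vectors. *)
pose C : 'M[K]_4 := \matrix_(i, j) nth 0 (nth [::]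
  [:: [:: x; 0; 0; 0]; [:: -1; 1; -y; -(x * y)]; [:: 0; 0; x; 0]; [:: 0; 0; 0; x]] i) j.
apply: (@unitmx_scalar _ _ C x) => //.
apply/matrixP; apply: ord4P; apply: ord4P; rewrite !mxE big_ord4 !mxE /=
  ?var_or_point_special ?var_eval ?special_configE ?rmorph_nat /quad_vec /=
  -/x -/y ?xz ?yz; ring.
Qed.
End SpecialConfig.

Section SpecialRank.
Variables (K : fieldType) (a d : nat) (m : a.-tuple nat).
Local Notation mm := (fun i => nth 0%N m i).
Local Notation D := (\dim {: dhomog 4 K d}).

(** The left kernel of the condition matrix consists of surfaces with the prescribed multiplicities
    at the special points, so [N] bounds its dimension. *)
Lemma special_rank N : (mm 0 <= d.+1)%N ->
  (forall i j, (i <= j)%N -> (mm j <= mm i)%N) ->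
  dim_le idfun (surfaces (K := K) d mm) N ->
  (D <= \rank (conds d m (@special_config K a)) + N)%N.
Proof.
move=> m0 mono HN; set M := conds d m _; pose k := kermx M.
pose w (j : 'I_D) : {mpoly K[4]} := mpoly_of_dhomog (\sum_i k j i *: basis_form i).
have [j|C HC] := HN D w.
  split; first exact: dhomog_is_dhomog.
  move=> i i8 b bm; have [ia|ai] := ltnP i a; last first.
    by move: bm; rewrite nth_default // size_tuple.
  have bd l : (b l < d.+1)%N.
    have : (b l <= \sum_j b j)%N by rewrite (bigD1 l) //= leq_addr.
    by have := mono 0%N i isT; lia.
  pose b' : {ffun 'I_4 -> 'I_d.+1} := [ffun l => Ordinal (bd l)].
  have E : row j k *m M = 0 by rewrite -row_mul mulmx_ker row0.
  have := row_conds m (@special_config K a) (row j k) (enum_rank (Ordinal ia, b')).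
  rewrite E mxE /condition enum_rankK /=.
  have -> : (\sum_j0 b' j0 = \sum_j0 b j0)%N by apply: eq_bigr => l _; rewrite ffunE.
  have -> : \sum_l row j k 0 l *: basis_form l = \sum_l k j l *: basis_form l.
    by apply: eq_bigr => l _; rewrite [row j k 0 l]mxE.
  rewrite bm /w => S; rewrite [RHS]S; apply: eq_bigr => u _; congr (_ * _); apply: eq_bigr => l _.
  by rewrite ffunE !mxE.
have CK (c : 'rV[K]_D) : c *m C = 0 -> c *m k = 0.
  move=> /HC E; apply/rowP => i; rewrite mxE [RHS]mxE.
  have /freeP F := basis_free (vbasisP (fullv : {vspace dhomog 4 K d})).
  apply: (F (fun i => \sum_j c 0 j * k j i)); apply: val_inj => /=.
  rewrite -[RHS]E /w.
  transitivity (mpoly_of_dhomog (\sum_j c 0 j *: \sum_i k j i *: basis_form i)).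
    congr mpoly_of_dhomog; under [RHS]eq_bigr => l _ do rewrite scaler_sumr.
    rewrite exchange_big; apply: eq_bigr => l _ /=; rewrite scaler_suml.
    by apply: eq_bigr => z _; rewrite scalerA.
  by rewrite linear_sum; apply: eq_bigr => l _; rewrite linearZ.
have K0 : kermx C *m k = 0.
  by apply/row_matrixP => i; rewrite row_mul row0 CK // -row_mul mulmx_ker row0.
have := mulmx0_rank_max K0; rewrite /k !mxrank_ker.
by have := rank_leq_col C; have := rank_leq_row M; have := rank_leq_row C; lia.
Qed.
End SpecialRank.

Lemma nth_sorted_geq (s : seq nat) i j :
  sorted geq s -> (i <= j)%N -> (nth 0 s j <= nth 0 s i)%N.
Proof.
move=> ss ij; have [js|sj] := ltnP j (size s); last by rewrite nth_default.
have geq_trans : transitive geq by move=> x y z /= h1 h2; apply: leq_trans h2 h1.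
have := @sorted_leq_nth _ geq geq_trans leqnn 0%N s ss i j.
by apply; rewrite // inE (leq_ltn_trans ij).
Qed.

(** * Integer formulas against truncated counts *)

Section Numerology.
Variables (a d : nat) (m : a.-tuple nat).
Hypothesis a_range : (1 <= a <= 8)%N.
Local Notation mm := (fun i => nth 0%N m i).
Hypothesis mono : forall i j, (i <= j)%N -> (mm j <= mm i)%N.

Lemma virtual_dimE :
  virtual_dim d m = 'C(d + 3, 3)%:Z - (\sum_(i < 8) 'C(mm i + 2, 3))%N%:Z - 1.
Proof.
rewrite /virtual_dim; congr (_ - _ - _).
have /andP[_ a8] := a_range.
have -> : (\sum_(i < 8) 'C(mm i + 2, 3) = \sum_(i < a) 'C(mm i + 2, 3))%N.
  rewrite (big_ord_widen 8 (fun i => 'C(mm i + 2, 3)) a8) big_mkcond [RHS]big_mkcond.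
  apply: eq_bigr => i _; case: ifP => // /negbT; rewrite -leqNgt => ai.
  by rewrite nth_default ?size_tuple.
rewrite -[RHS]natz natr_sum; apply: eq_bigr => i _.
by rewrite natz (tnth_nth 0%N).
Qed.

Lemma line_term (x y : nat) :
  (if 2 <= x%:Z + y%:Z - d%:Z then 'C(absz (x%:Z + y%:Z - d%:Z + 1)%R, 3)%:Z else 0)
  = 'C((x + y - d).+1, 3)%:Z.
Proof.
case: ifP => h; first by congr ('C(_, _)%:Z); lia.
by rewrite bin_small //; lia.
Qed.

Lemma line_excessE : (mm 0 <= d.+1)%N ->
  \sum_(1 <= i < a.+1 | 2 <= t_ d m i) 'C(absz (t_ d m i + 1)%R, 3)%:Z =
  (line_excess d mm)%:Z.
Proof.
move=> m0; have /andP[a1 a8] := a_range.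
rewrite big_mkcond big_ltn //= /t_ /= line_term /line_excess PoszD; congr (_ + _).
have -> : (\sum_(1 <= i < 8) 'C((mm 0 + mm i - d).+1, 3) =
           \sum_(1 <= i < a) 'C((mm 0 + mm i - d).+1, 3))%N.
  rewrite (big_cat_nat a1 a8) /= [X in (_ + X)%N]big_nat [X in (_ + X)%N]big1 ?addn0 // => i /andP[ai _].
  by rewrite [nth 0 m i]nth_default ?size_tuple // bin_small //; lia.
rewrite -[RHS]natz natr_sum big_add1 /=; apply: eq_big_nat => i /andP[i1 _].
by rewrite natz -line_term; case: i i1.
Qed.

(** By monotonicity [p_1 p_2] has the largest [t_i], so some line contributes exactly when this one
    does. *)
Lemma line_excess_gt0 : (mm 0 <= d.+1)%N -> (mm 0 + mm 1 + mm 2 + mm 3 <= 2 * d)%N ->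
  (0 < line_excess d mm)%N = (d + 2 <= mm 0 + mm 1)%N.
Proof.
move=> m0 std; rewrite /line_excess big_ltn //; apply/idP/idP => h; last first.
  by rewrite addnCA addn_gt0 bin_gt0; apply/orP; left; lia.
rewrite leqNgt; apply/negP => lt; move: h.
have h1 := mono (leqnSn 0); have h2 := mono (leqnSn 1).
rewrite !addn_gt0 !bin_gt0 => /orP[|/orP[|]]; try lia.
rewrite big_nat big1 // => i /andP[i2 _]; rewrite bin_small //.
by have := mono (ltnW i2); lia.
Qed.
End Numerology.

(** * General configurations *)

Section General.
Variables (K : fieldType) (a d : nat) (m : a.-tuple nat).
Hypothesis char0 : [pchar K] =i pred0.
Hypothesis a_range : (1 <= a <= 8)%N.
Local Notation mm := (fun i => nth 0%N m i).
Hypothesis mono : forall i j, (i <= j)%N -> (mm j <= mm i)%N.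
Hypothesis m0_le : (mm 0 <= d.+1)%N.
Hypothesis std : (mm 0 + mm 1 + mm 2 + mm 3 <= 2 * d)%N.

Lemma general_dim : exists F : {mpoly K[a * 4]},
  [/\ multihomogeneous F, eval_config F (@special_config K a) != 0 &
   forall p, eval_config F p != 0 ->
     (\dim (linear_system d m p) + \sum_(i < 8) 'C(mm i + 2, 3) =
      'C(d + 3, 3) + line_excess d mm)%N].
Proof.
have /andP[a1 a8] := a_range.
have [N [EN HN]] := surfaces_bound char0 mono m0_le std.
have rk := special_rank m0_le mono HN.
have [f [g fg]] := unit_minor (conds d m (@special_config K a)).
pose G := mxsub f g (cond_poly K d m).
(* The first factors keep the coordinate systems of the lower bound invertible; the minor keeps the
   rank at least that of the special configuration. The transpose puts the conditions on rows, where
   [det_homog] reads the degrees. *)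
pose F := \det (frame_poly K a) * (\prod_(k < a | (4 <= k)%N) \det (pair_poly K k)) * \det G^T.
have FE p : eval_config F p =
    \det (map_mx (meval (coords p)) (frame_poly K a)) *
    (\prod_(k < a | (4 <= k)%N) \det (map_mx (meval (coords p)) (pair_poly K k))) *
    \det (mxsub f g (conds d m p)).
  rewrite /eval_config -[meval _ _]/(meval (coords p) F) /F !rmorphM rmorph_prod /=.
  rewrite det_tr /conds -map_mxsub !det_map_mx.
  by congr (_ * _ * _); apply: eq_bigr => k _; rewrite det_map_mx.
exists F; split.
- pose e (i0 : 'I_a) := ((\sum_(i < 4) (i == i0 :> nat)) +
     \sum_(k < a | (4 <= k)%N) (\sum_(i < 4) nth 0%N [:: (0 == i0 :> nat) : nat; (k == i0) : nat; 0; 0]%N i) +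
     \sum_t ((d - \sum_j (condition (g t)).2 j) * ((condition (g t)).1 == i0)))%N.
  apply: (@multihomogeneousP _ _ _ e) => i0; apply: dhomogM; first apply: dhomogM.
  + by apply: det_homog => i j; rewrite mxE; apply: var_or_point_homog.
  + apply: prod_homog => k _; apply: det_homog => i j; rewrite mxE; move: i.
    apply: ord4P => /=; [exact: var_or_point_homog | exact: var_homog | |];
      by rewrite -mpolyC_nat; apply: const_homog.
  + by apply: det_homog => i j; rewrite mxE [G _ _]mxE; apply: cond_poly_homog.
- rewrite FE !mulf_neq0 //.
  + by rewrite frame_special -unitfE -unitmxE frame_unit.
  + apply/prodf_neq0 => k k4; rewrite -unitfE -unitmxE pair_special //.
    exact: leq_trans k4.
  + by rewrite -unitfE -unitmxE.
move=> p; rewrite FE !mulf_eq0 !negb_or => /andP[/andP[uA /prodf_neq0 uB] uG].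
rewrite -unitfE -unitmxE in uA; rewrite -unitfE -unitmxE in uG.
have upper : (\dim (linear_system d m p) <= N)%N.
  have := dim_le_rank (@system_conds _ _ d m p); have := minor_rank uG; lia.
have lower := @dim_lower K a d m p a8 mono m0_le std
  (map_mx (meval (coords p)) (frame_poly K a)) uA _
  (fun k => map_mx (meval (coords p)) (pair_poly K k)) _ _ _.
suff : ('C(d + 3, 3) + line_excess d mm <=
   \dim (linear_system d m p) + \sum_(i < 8) 'C(mm i + 2, 3))%N by lia.
have vE (i : 'I_a) j : (var_or_point K a i j).@[coords p] = val (p i) 0 j.
  by rewrite /var_or_point valK var_eval.
apply: lower.
- by move=> i k ik j; rewrite !mxE -ik vE.
- by move=> k k4; rewrite unitmxE unitfE uB.
- by move=> k i0 k4 E j; have := vE i0 j; rewrite E => <-; rewrite !mxE.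
- by move=> k k4 j; rewrite !mxE /= var_eval.
Qed.
End General.

Theorem theorem5p3 (K : closedFieldType) (char0 : [pchar K] =i pred0)
    (a d : nat) (ha : (1 <= a <= 8)%N) (m : a.-tuple nat)
    (hstd : standard_form d m) :
  for_general_points (fun p : config K a =>
    (special d m p <-> d%:Z <= (mult m 1)%:Z + (mult m 2)%:Z - 2) /\
    ((mult m 1 <= d + 1)%N ->
       dim_system d m p =
         virtual_dim d m +
         \sum_(1 <= i < a.+1 | 2 <= t_ d m i)
           'C(absz (t_ d m i + 1)%R, 3)%:Z)).
Proof.
have [hs std] := hstd; pose mm i := nth 0%N m i.
have mono i j : (i <= j)%N -> (mm j <= mm i)%N by apply: nth_sorted_geq.
have std' : (mm 0 + mm 1 + mm 2 + mm 3 <= 2 * d)%N by [].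
have [m0|m0] := leqP (mm 0%N) d.+1; last first.
  (* When [m_1 >= d + 2], both sides of the equivalence hold for all points: [C(m_1 + 2, 3)] is at
     least [C(d + 4, 3)], so the virtual dimension is below -1. The open set is the whole space,
     given by the constant polynomial 1. *)
  exists (fun=> True); split; last 1 first.
  - move=> p _; split; last by rewrite addn1 leqNgt m0.
    split=> [_|_]; first by rewrite /mult /= -/(mm 0%N) -/(mm 1%N); lia.
    rewrite /special /dim_system (virtual_dimE d m ha).
    suff : ('C(d + 3, 3) < \sum_(i < 8) 'C(nth 0%N m i + 2, 3))%N by lia.
    have m0' : (d.+1 < nth 0%N m 0)%N := m0.
    rewrite big_ord_recl /= (leq_trans (n := 'C(d.+4, 3))) //.
      by rewrite addn3 [X in (_ < X)%N]binS -addn1 leq_add2l bin_gt0.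
    by apply: leq_trans (leq_addr _ _); apply: leq_bin2l; lia.
  - exists (fun F => F = 1); split=> [F ->|p].
      by exists (fun=> 0%N) => u; rewrite msupp1 inE => /eqP -> i; rewrite big1 // => j _; rewrite mnm0E.
    by split=> // _; exists 1 => //; rewrite /eval_config meval1 oner_neq0.
  - by exists (@special_config K a).
have [F [hF F0 HF]] := general_dim char0 ha mono m0 std'.
exists (fun p => eval_config F p != 0); split; last 1 first.
- move=> p /HF dimE; rewrite /special /dim_system (virtual_dimE d m ha) line_excessE //.
  split; last by move: dimE; lia.
  have gt0 : (0 < line_excess d (fun i => nth 0%N m i))%N =
    (d + 2 <= nth 0%N m 0 + nth 0%N m 1)%N := line_excess_gt0 ha mono m0 std'.
  rewrite /mult /=; move: dimE gt0; move: (line_excess _ _) (\sum_(i < 8) _)%N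
    (\dim _) (nth _ _ 0%N) (nth _ _ 1%N) 'C(_, _) => e s w u v c.
  by case: e => [|e] dimE gt0; split=> h; lia.
- exists (fun G => G = F); split=> [G -> //|p].
  by split=> [Fp|[G ->]] //; exists F.
- by exists (@special_config K a).
Qed.
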